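(* Let $\Omega\subset\mathbb{R}^n$ be a $C^1$ domain and let $u\in C^3$ be a bounded solution of $$\begin{cases}\mathrm{div}\left(\dfrac{\nabla u}{\sqrt{1+|\nabla u|^2}}\right)+f(u)=0 & \text{in }\Omega,\\ u>0 & \text{in }\Omega,\\ u=0 & \text{on }\partial\Omega,\\ \partial_\nu u=\kappa & \text{on }\partial\Omega,\end{cases}$$ for some function $f\in C^1(\mathbb{R})$ and some constant $\kappa$. Assume that $f'(u)\le 0$ in $\Omega$. Then $$\|\nabla u\|_{L^\infty(\Omega)}\le C,$$ where $C$ depends only on $n$, $\kappa$, $\|u\|_{L^\infty(\Omega)}$ and $\|f(u)\|_{L^\infty(\Omega)}$.
   Context: $\nu$ is the exterior unit normal on $\partial\Omega$. The solution $u$ is of class $C^3$ in $\Omega$ and of class $C^1$ up to the boundary. The domain $\Omega$ may be unbounded. $f'(u)\le0$ means $f'(u(x))\le 0$ for all $x\in\Omega$. *)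

(* Defs.v *)
From HB Require Import structures.
From mathcomp Require Import all_boot all_order all_algebra.
From mathcomp Require Import all_classical all_reals all_analysis.

Set Implicit Arguments.
Unset Strict Implicit.
Unset Printing Implicit Defensive.

Import Order.TTheory GRing.Theory Num.Theory.
Import numFieldNormedType.Exports.

Local Open Scope classical_set_scope.
Local Open Scope ring_scope.

Section Euclidean.
Variables (R : realType) (n : nat).
Implicit Types (v w x : 'rV[R]_n) (u : 'rV[R]_n -> R) (A Omega : set 'rV[R]_n).

(* The library norm on 'rV[R]_n is the max norm, hence the Euclidean one below.
   Both induce the same topology. *)
Definition dot v w : R := \sum_(i < n) v 0 i * w 0 i.
Definition enorm v : R := Num.sqrt (dot v v).

Definition partial (i : 'I_n) u x : R := 'D_(delta_mx 0 i) u x.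
Definition grad u x : 'rV[R]_n := \row_(i < n) partial i u x.
Definition divergence (X : 'rV[R]_n -> 'rV[R]_n) x : R :=
  \sum_(i < n) partial i (fun y => X y 0 i) x.

(* u is of class C^k in the open set Omega. *)
Fixpoint Ck (k : nat) Omega u : Prop :=
  (forall x, Omega x -> {for x, continuous u}) /\
  if k is k'.+1 then
    forall i : 'I_n,
      (forall x, Omega x -> derivable u x (delta_mx 0 i)) /\
      Ck k' Omega (partial i u)
  else True.

(* u is of class C^1 up to the boundary of the open set Omega, and Du is the
   continuous extension of its gradient to the closure; Du is unique there. *)
Definition C1_closure Omega u (Du : 'rV[R]_n -> 'rV[R]_n) : Prop :=
  [/\ Ck 1 Omega u,
      {within closure Omega, continuous u},
      {within closure Omega, continuous Du} &
      forall x, Omega x -> Du x = grad u x].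

(* Lebesgue-null sets, by countable covers with boxes of small total volume
   (the library has no Lebesgue measure on 'rV[R]_n). *)
Definition lebesgue_null A : Prop :=
  forall e : R, 0 < e ->
  exists a b : nat -> 'rV[R]_n,
    [/\ forall k i, a k 0 i <= b k 0 i,
        A `<=` \bigcup_k [set x : 'rV[R]_n | forall i, a k 0 i <= x 0 i <= b k 0 i] &
        (\sum_(0 <= k <oo) (\prod_(i < n) (b k 0 i - a k 0 i))%:E <= e%:E)%E].

(* The norm of L^oo(Omega); it is +oo when g is not essentially bounded. *)
Definition Linfty_norm Omega (g : 'rV[R]_n -> R) : \bar R :=
  ereal_inf [set M%:E | M in
    [set M : R | 0 <= M /\ lebesgue_null [set x | Omega x /\ M < `|g x|]]].

End Euclidean.

Section Domains.
Variables (R : realType) (n : nat).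
Implicit Types (x nu : 'rV[R]_n.+1) (Omega : set 'rV[R]_n.+1).
Implicit Types (Q : 'M[R]_n.+1) (gamma : 'rV[R]_n -> R).

Definition bdry Omega := closure Omega `\` interior Omega.

(* After the orthogonal change of coordinates y = x *m Q, Omega is near x0 the
   strict epigraph of the C^1 function gamma:  y_last > gamma y', where y' are
   the first n coordinates of y. *)
Definition C1_chart Omega x0 Q gamma : Prop :=
  [/\ Q *m Q^T = 1%:M,
      Ck 1 setT gamma &
      \forall x \near x0,
        Omega x <-> gamma (col' ord_max (x *m Q)) < (x *m Q) 0 ord_max].

Definition C1_domain Omega : Prop :=
  [/\ open Omega, connected Omega, Omega !=set0 &
      forall x0, bdry Omega x0 -> exists Q gamma, C1_chart Omega x0 Q gamma].

(* In chart coordinates nu is (grad gamma, -1) / sqrt (1 + |grad gamma|^2),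
   evaluated at the point of the graph corresponding to x. *)
Definition exterior_normal Omega x nu : Prop :=
  exists Q gamma, C1_chart Omega x Q gamma /\
    let dg := grad gamma (col' ord_max (x *m Q)) in
    let c := (Num.sqrt (1 + enorm dg ^+ 2))^-1 in
    col' ord_max (nu *m Q) = c *: dg /\ (nu *m Q) 0 ord_max = - c.

Definition mean_curvature_op (u : 'rV[R]_n.+1 -> R) x : R :=
  divergence (fun y => (Num.sqrt (1 + enorm (grad u y) ^+ 2))^-1 *: grad u y) x.

Definition overdetermined_solution Omega (f : R -> R) (kappa : R)
    (u : 'rV[R]_n.+1 -> R) : Prop :=
  Ck 3 Omega u /\
  exists2 Du, C1_closure Omega u Du &
    [/\ forall x, Omega x -> mean_curvature_op u x + f (u x) = 0,
        forall x, Omega x -> 0 < u x,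
        forall x, bdry Omega x -> u x = 0 &
        forall x nu, bdry Omega x -> exterior_normal Omega x nu ->
          dot (Du x) nu = kappa].

End Domains.

Definition C1_real (R : realType) (f : R -> R) : Prop :=
  (forall t, derivable f t 1) /\ continuous (derive1 f).

(* Main.v *)
Require Import Defs.
From HB Require Import structures.
From mathcomp Require Import all_boot all_order all_algebra.
From mathcomp Require Import all_classical all_reals all_analysis.
From mathcomp Require Import measurable_realfun.
From mathcomp Require Import ring lra.
Import Order.TTheory GRing.Theory Num.Theory.
Import numFieldNormedType.Exports.
Local Open Scope classical_set_scope.
Local Open Scope ring_scope.

(** The proof is a Bernstein argument with a Korevaar cutoff: a power of a
    cutoff times [Wsq u] = 1 + |grad u|^2 is maximised, and no estimate
    depends on the geometry of the domain.

    Fix x0 in Omega, let M and F bound u and f(u), and put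
      phi(y) = 1 + c u(y) - |y - x0|^2 / r,  c = 1 / (M + 1),  r = 256 / c^2.
    Since 0 <= c u <= 1, phi is at most 2 on the closure of Omega, is at least
    1 at x0, and is nonpositive once |y - x0|^2 >= 2 r.  So the maximum of
    max(phi, 0)^k (1 + |Du|^2) over the closure of Omega intersected with the
    ball |y - x0|^2 <= 2 r exists by compactness, even when Omega is unbounded,
    and phi is positive where it is attained.  There are two cases.

    - The maximum point lies on the boundary.  As u vanishes on a C^1 graph,
      its tangential derivatives vanish there ([tangential_derivative]), hence
      |Du|^2 = kappa^2 ([boundary_gradient]).

    - The maximum point x is interior.  Write p = grad u, Q = 1 + |p|^2,
      W = sqrt Q, let A = I - p p^T / Q be the inverse metric of the graph of u,
      and T the derivative of the Hessian in the direction p.  The first and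
      second order conditions along every line through x ([line_test]) are
      summed over a family of vectors whose tensor squares add up to A
      ([inverse_metric_frame]); the trace of A T which appears is computed by
      differentiating the equation in the direction p
      ([differentiated_equation]).  The term f'(u) |p|^2 has the favourable
      sign because f'(u) <= 0.  What remains ([contracted_inequality]) is
        (k/2 - 1) A(grad phi, grad phi)
           <= phi (c f / W + 2 tr A / r + 2 f p.(x - x0) / (r W)).
      The right side is bounded in terms of n, M and F.  If |p| >= 1 the
      choice of r makes A(grad phi, grad phi) at least c^2 / 4, because c u
      dominates the quadratic part of phi.  So for k large, depending only on
      n, M and F, one gets |p| < 1 ([interior_maximum]).

    In both cases Q(x0) <= 2^k (2 + kappa^2).

    Finally M and F have to be the essential suprema of the statement.  For a
    continuous function on an open set they are pointwise bounds, since a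
    nonempty open set is not null ([open_not_null]): integrating one coordinate
    at a time shows that countably many boxes covering a box have at least its
    volume ([box_cover_volume]). *)

(** * Calculus on lines and for C^1 functions *)

Section Lines.
Context {R : realType} {V : normedModType R}.
Implicit Types (f : V -> R) (x v : V).

Lemma is_derive_line f x v (t df : R) :
  is_derive (x + t *: v) v f df -> is_derive t 1 (fun s => f (x + s *: v)) df.
Proof.
case=> fd fE.
have E : (fun h : R => h^-1 *: (((fun s => f (x + s *: v)) \o shift t) (h *: 1) - f (x + t *: v)))
  = (fun h => h^-1 *: ((f \o shift (x + t *: v)) (h *: v) - f (x + t *: v))).
  rewrite funeqE => h /=; congr (_ *: (f _ - _)).
  by rewrite [h%:A]mulr1 scalerDl addrCA.
by split; [rewrite /derivable E | rewrite /derive E].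
Qed.

Lemma is_derive_scale_dir f x v (s df : R) :
  is_derive x v f df -> is_derive x (s *: v) f (s * df).
Proof.
move=> fd.
have fd1 : is_derive ((fun r : R => r * s) 0) 1 (fun r => f (x + r *: v)) df.
  by rewrite /= mul0r; apply: is_derive_line; rewrite scale0r addr0.
have g1 : is_derive (0:R) 1 (fun r : R => r * s) s.
  apply: is_derive_eq; rewrite scaler0 add0r.
  by rewrite /GRing.scale/= mulr1.
have [] := @is_derive1_comp _ (fun r => f (x + r *: v)) (fun r : R => r * s) 0 _ _ fd1 g1.
rewrite /derivable /derive.
have -> : (fun h : R => h^-1 *: ((((fun r => f (x + r *: v)) \o (fun r => r * s)) \o shift 0) h%:A
   - ((fun r => f (x + r *: v)) \o (fun r => r * s)) 0)) =
   (fun h => h^-1 *: ((f \o shift x) (h *: (s *: v)) - f x)).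
  rewrite funeqE => h /=; rewrite mul0r scale0r !addr0 [h%:A]mulr1 scalerA.
  by rewrite (addrC x).
by move=> d1 d2; split=> //; rewrite mulrC.
Qed.

Lemma is_derive_translate f x v w df :
  is_derive (x + w) v f df -> is_derive x v (fun y => f (y + w)) df.
Proof.
case=> fd fE.
have E : (fun h : R => h^-1 *: (((fun y => f (y + w)) \o shift x) (h *: v) - f (x + w)))
  = (fun h => h^-1 *: ((f \o shift (x + w)) (h *: v) - f (x + w))).
  by rewrite funeqE => h /=; rewrite addrA.
by split; [rewrite /derivable E | rewrite /derive E].
Qed.

Lemma MVT_line f x v :
  (forall t : R, 0 <= t <= 1 -> derivable f (x + t *: v) v) ->
  exists2 t : R, 0 <= t <= 1 & f (x + v) - f x = 'D_v f (x + t *: v).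
Proof.
move=> fd.
have gd (t : R) : 0 <= t <= 1 ->
    is_derive t 1 (fun s => f (x + s *: v)) ('D_v f (x + t *: v)).
  by move=> /fd /derivableP /is_derive_line.
have [|||c c01 E] := @MVT _ (fun s => f (x + s *: v))
  (fun t => 'D_v f (x + t *: v)) 0 1.
- exact: ltr01.
- by move=> t; rewrite in_itv /= => /andP[t0 t1]; apply: gd; rewrite !ltW.
- apply: derivable_within_continuous => t; rewrite in_itv /= => t01.
  by have [] := gd t t01.
exists c; first by move: c01; rewrite in_itv /= => /andP[? ?]; rewrite !ltW.
by move: E; rewrite subr0 mulr1 scale1r scale0r addr0.
Qed.

End Lines.

Section C1.
Context {R : realType} {n : nat}.
Local Notation V := 'rV[R]_n.
Implicit Types (u : V -> R) (x y z v : V) (Omega : set V).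

Lemma CkW k Omega u : Ck k.+1 Omega u -> Ck k Omega u.
Proof.
elim: k u => [|k IH] u /=; first by case.
by case=> uc H; split=> // i; have [? K] := H i; split=> //; apply: IH.
Qed.

Let hybrid y z (k : nat) : V := \row_i (if (i < k)%N then z 0 i else y 0 i).

(** Continuity of the partial derivatives at x alone controls increments
    between two arbitrary points near x: go from y to z one coordinate at a
    time.  The max norm makes this possible, as its balls are boxes and contain
    all the intermediate points. *)
Lemma strictly_differentiable Omega u x (e : R) :
  open Omega -> Ck 1 Omega u -> Omega x -> 0 < e ->
  \forall d \near (0:R)^'+, ball x d `<=` Omega /\ forall y z, ball x d y -> ball x d z ->
    `|u z - u y - \sum_(i < n) (z 0 i - y 0 i) * partial i u x|
      <= e * \sum_(i < n) `|z 0 i - y 0 i|.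
Proof.
move=> oO [_ u1] Ox e0.
have : \forall w \near x, Omega w /\
    forall i : 'I_n, `|partial i u x - partial i u w| < e.
  apply: filterI; first exact: open_nbhs_nbhs.
  apply: (@filter_forall _ _ (fun i => [set w | `|partial i u x - partial i u w| < e]) (nbhs x) (nbhs_filter x)) => i.
  have [_ [/(_ x Ox) ci _]] := u1 i.
  exact: (cvgr_dist_lt _ _ ci _ e0).
move=> /nbhs_ballP[d0 /= d00 Hd0].
near=> d.
have Hd w : ball x d w -> Omega w /\ forall i : 'I_n, `|partial i u x - partial i u w| < e.
  move=> xw; apply: Hd0; apply: le_ball xw; near: d.
  exact: nbhs_right_le.
split=> [w /Hd[]//|y z xy xz].
have hyb0 : hybrid y z 0 = y by apply/rowP => i; rewrite mxE ltn0.
have hybn : hybrid y z n = z by apply/rowP => i; rewrite mxE ltn_ord.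
have hybS (k : 'I_n) : hybrid y z k.+1 =
    hybrid y z k + (z 0 k - y 0 k) *: delta_mx 0 k.
  apply/rowP => i; rewrite !mxE ltnS leq_eqVlt eqxx /=.
  have [->|ik] := eqVneq i k; first by rewrite eqxx ltnn mulr1 subrKC.
  have -> : (i == k :> nat) = false by apply/negbTE.
  by rewrite mulr0 addr0.
have hyb_ball (k : 'I_n) (t : R) : 0 <= t <= 1 ->
    ball x d (hybrid y z k + t *: ((z 0 k - y 0 k) *: delta_mx 0 k)).
  move=> /andP[t0 t1]; split=> [|a i]; first by case: xy.
  rewrite !mxE (ord1 a).
  have := xy.2 0 i; have := xz.2 0 i; rewrite /ball /= => Hz Hy.
  have [<-|ik] := eqVneq i k; rewrite ?eqxx /=.
    rewrite ltnn mulr1.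
    have -> : x 0 i - (y 0 i + t * (z 0 i - y 0 i)) =
       (1 - t) * (x 0 i - y 0 i) + t * (x 0 i - z 0 i) by ring.
    rewrite (le_lt_trans (ler_normD _ _))// !normrM (ger0_norm t0) (ger0_norm (x:=1-t)); last by lra.
    move: Hy Hz; move: `|x 0 i - y 0 i| `|x 0 i - z 0 i| => a' b' Ha Hb.
    apply: (@le_lt_trans _ _ (Num.max a' b')); last by rewrite gt_max Ha Hb.
    have a'm : a' <= Num.max a' b' by rewrite le_max lexx.
    have b'm : b' <= Num.max a' b' by rewrite le_max lexx orbT.
    by nra.
  by rewrite ?andbF ?mulr0n !mulr0 addr0; case: ifP.
have := @telescope_sumr _ 0 n (fun k => u (hybrid y z k)) isT.
rewrite big_mkord /= hybn hyb0 => <-.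
rewrite -sumrB mulr_sumr.
apply: le_trans (ler_norm_sum _ _ _) _; apply: ler_sum => k _.
have [|t t01 E] := @MVT_line _ _ u (hybrid y z k) ((z 0 k - y 0 k) *: delta_mx 0 k).
  move=> t t01.
  have Ot := (Hd _ (hyb_ball k t t01)).1.
  have [/(_ _ Ot)/derivableP H _] := u1 k.
  by have [] := is_derive_scale_dir _ _ _ (z 0 k - y 0 k) _ H.
rewrite hybS E.
have [Ot Ht] := Hd _ (hyb_ball k t t01).
have [/(_ _ Ot)/derivableP H _] := u1 k.
have [_ ->] := is_derive_scale_dir _ _ _ (z 0 k - y 0 k) _ H.
rewrite -mulrBr normrM mulrC ler_wpM2r// distrC.
exact/ltW/Ht.
Unshelve. all: by end_near. Qed.

Lemma C1_diff {Omega u x} : open Omega -> Ck 1 Omega u -> Omega x ->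
  is_diff x u (fun v => \sum_(i < n) v 0 i * partial i u x).
Proof.
move=> oO u1 Ox.
pose L v : R := \sum_(i < n) v 0 i * partial i u x.
have linL : linear L.
  move=> a v w; rewrite /L scaler_sumr -big_split /=; apply: eq_bigr => i _.
  by rewrite !mxE mulrDl -mulrA.
pose scallM := GRing.isLinear.Build _ _ _ _ _ linL.
pose LL : {linear _ -> _} := HB.pack L scallM.
have contL : continuous LL.
  apply: (@continuous_big _ _ +%R 0); first exact: add_continuous.
  move=> i _ v; apply: (@cvgMr_tmp _ _ (nbhs v) (nbhs_filter v) (fun w : V => w 0 i)).
  exact: coord_continuous.
have littleL : u \o shift x = cst (u x : R^o) + (LL : V -> R^o) +o_ (0 : V) id.
  apply/eqaddoP => e e0.
  have n1 : 0 < n.+1%:R :> R by rewrite ltr0n.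
  near (0:R)^'+ => d.
  have [] : ball x d `<=` Omega /\ forall y z, ball x d y -> ball x d z ->
    `|u z - u y - \sum_(i < n) (z 0 i - y 0 i) * partial i u x|
      <= e / n.+1%:R * \sum_(i < n) `|z 0 i - y 0 i|.
    by near: d; apply: strictly_differentiable => //; exact: divr_gt0.
  have d0 : 0 < d by near: d; exact: nbhs_right_gt.
  move=> _ H.
  have nd : \forall h \near (0 : V), `|h| < d by exact: nbhs0_lt.
  near=> h.
  have := H x (h + x); rewrite -ball_normE /= subrr normr0 => /(_ d0).
  rewrite opprD addrCA subrr addr0 normrN.
  have hd : `|h| < d by near: h.
  move=> /(_ hd).
  have -> : \sum_(i < n) ((h + x) 0 i - x 0 i) * partial i u x = L h.
    by apply: eq_bigr => i _; rewrite !mxE addrK.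
  have -> : \sum_(i < n) `|(h + x) 0 i - x 0 i| = \sum_(i < n) `|h 0 i|.
    by apply: eq_bigr => i _; rewrite !mxE addrK.
  rewrite -[(_ - _) h]/(u (h + x) - (u x + L h)) opprD addrA => /le_trans; apply.
  rewrite -mulrA ler_wpM2l ?(ltW e0)// mulrC ler_pdivrMr//.
  have -> : `|h| * n.+1%:R = `|h| + \sum_(i < n) `|h|.
    by rewrite sumr_const card_ord mulrS mulrDr mulr1 mulr_natr.
  rewrite -[leLHS]add0r lerD//; apply: ler_sum => i _.
  rewrite [leRHS]/Num.Def.normr/= mx_normrE.
  exact: (le_bigmax _ (fun ij : 'I_1 * 'I_n => `|h ij.1 ij.2|) (0, i)).
have dE : 'd u x = LL :> (V -> R) by apply: diff_unique.
apply: DiffDef => //; apply/diff_locallyP; by rewrite dE; split.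
Unshelve. all: by end_near. Qed.

Lemma C1_is_derive {Omega u x} v : open Omega -> Ck 1 Omega u -> Omega x ->
  is_derive x v u (\sum_(i < n) v 0 i * partial i u x).
Proof.
move=> oO u1 Ox; have [ud uE] := C1_diff oO u1 Ox.
by split; [exact: diff_derivable | rewrite deriveE// uE].
Qed.

Lemma C1_curve {Omega u} {c : R -> V} {dc : V} {t : R} :
  open Omega -> Ck 1 Omega u -> Omega (c t) ->
  (forall i, is_derive t 1 (fun s => c s 0 i) (dc 0 i)) ->
  is_derive t 1 (u \o c) (\sum_(i < n) dc 0 i * partial i u (c t)).
Proof.
move=> oO u1 Ox dcE.
have cd : derivable c t 1.
  by apply/derivable_mxP => i j; rewrite (ord1 i); have [] := dcE j.
have cE : 'D_1 c t = dc.
  rewrite derive_mx//; apply/rowP => i; rewrite !mxE.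
  by have [_ ->] := dcE i.
have [ud uE] := C1_diff oO u1 Ox.
have cd' : differentiable c t by apply/derivable1_diffP.
have ucd : differentiable (u \o c) t by apply: differentiable_comp.
split; first by apply/derivable1_diffP.
have d1 : 'd c t 1 = dc by rewrite -deriveE.
by rewrite deriveE// diff_comp//= d1 uE.
Qed.

(** Both orders of differentiation will be compared with the same second
    difference, which is symmetric in i and j. *)
Lemma mixed_difference Omega u x (i j : 'I_n) (e : R) :
  open Omega -> Ck 2 Omega u -> Omega x -> 0 < e ->
  exists2 d : R, 0 < d & forall s, 0 < s < d ->
   `|u (x + s *: delta_mx 0 i + s *: delta_mx 0 j) - u (x + s *: delta_mx 0 i)
     - u (x + s *: delta_mx 0 j) + u x - s ^+ 2 * partial j (partial i u) x|
    <= e * s ^+ 2.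
Proof.
move=> oO u2 Ox e0.
have [_ H] := u2.
have [ui_d ui1] := H i.
near (0:R)^'+ => d.
have [BO uiB] : ball x d `<=` Omega /\ forall y z, ball x d y -> ball x d z ->
    `|partial i u z - partial i u y - \sum_(k < n) (z 0 k - y 0 k) * partial k (partial i u) x|
      <= e * \sum_(k < n) `|z 0 k - y 0 k|.
  by near: d; apply: strictly_differentiable.
have d0 : 0 < d by near: d; exact: nbhs_right_gt.
have d20 : 0 < d / 2 by lra.
exists (d / 2) => // s /andP[s0 sd].
have inB (a b : R) : 0 <= a <= 1 -> 0 <= b <= 1 ->
    ball x d (x + a *: (s *: delta_mx 0 i) + b *: (s *: delta_mx 0 j)).
  move=> a01 b01; split=> // k l; rewrite !mxE /ball /= (ord1 k).
  rewrite [X in `|X|](_ : _ = - (a * (s * (l == i)%:R) + b * (s * (l == j)%:R))); last by rewrite eqxx/=; ring.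
  rewrite normrN ger0_norm; last by rewrite addr_ge0// !mulr_ge0//; lra.
  by case: (l == i); case: (l == j); rewrite /=; nra.
pose g y := u (y + s *: delta_mx 0 j) - u y.
have gd (t : R) : 0 <= t <= 1 -> is_derive (x + t *: (s *: delta_mx 0 i)) (s *: delta_mx 0 i) g
   (s * (partial i u (x + t *: (s *: delta_mx 0 i) + s *: delta_mx 0 j) - partial i u (x + t *: (s *: delta_mx 0 i)))).
  move=> t01.
  have i01 : 0 <= (1:R) <= 1 by rewrite lexx ler01.
  have i00 : 0 <= (0:R) <= 1 by rewrite lexx ler01.
  have := inB t 0 t01 i00; rewrite scale0r addr0 => /BO/ui_d/derivableP D0.
  have := inB t 1 t01 i01; rewrite scale1r => /BO/ui_d/derivableP D1.
  apply: is_derive_scale_dir; apply: is_deriveB.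
    exact: is_derive_translate.
  exact: D0.
have gd' (t : R) : 0 <= t <= 1 ->
    derivable g (x + t *: (s *: delta_mx 0 i)) (s *: delta_mx 0 i).
  by move=> /gd[].
have [t t01 E] := MVT_line _ _ _ gd'.
have [_ gE] := gd t t01; rewrite gE in E.
have -> : u (x + s *: delta_mx 0 i + s *: delta_mx 0 j) - u (x + s *: delta_mx 0 i)
     - u (x + s *: delta_mx 0 j) + u x = g (x + s *: delta_mx 0 i) - g x.
  by rewrite /g; ring.
rewrite E expr2 -mulrA -mulrBr normrM (gtr0_norm s0) mulrCA ler_wpM2l ?(ltW s0)//.
have i01 : 0 <= (1:R) <= 1 by rewrite lexx ler01.
have i00 : 0 <= (0:R) <= 1 by rewrite lexx ler01.
have := inB t 0 t01 i00; rewrite scale0r addr0 => B0.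
have := inB t 1 t01 i01; rewrite scale1r => B1.
have := uiB _ _ B0 B1.
have D k : (x + t *: (s *: delta_mx 0 i) + s *: delta_mx 0 j) 0 k
    - (x + t *: (s *: delta_mx 0 i)) 0 k = s * (k == j)%:R.
  by rewrite !mxE eqxx /=; ring.
rewrite (bigD1 j)//= big1 => [|k kj]; last by rewrite D (negbTE kj) mulr0 mul0r.
rewrite (bigD1 j)//= big1 => [|k kj]; last by rewrite D (negbTE kj) mulr0 normr0.
by rewrite !D eqxx mulr1 !addr0 (gtr0_norm s0).
Unshelve. all: by end_near. Qed.

Lemma partialC {Omega u x} (i j : 'I_n) :
  open Omega -> Ck 2 Omega u -> Omega x ->
  partial j (partial i u) x = partial i (partial j u) x.
Proof.
move=> oO u2 Ox; apply/eqP; rewrite -subr_eq0 -normr_le0.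
apply/ler_addgt0Pl => e e0; rewrite addr0.
have e20 : 0 < e / 2 by lra.
have [d1 d10 nij] := mixed_difference Omega u x i j _ oO u2 Ox e20.
have [d2 d20 nji] := mixed_difference Omega u x j i _ oO u2 Ox e20.
pose s := Num.min d1 d2 / 2.
have s0 : 0 < s by rewrite divr_gt0// lt_min d10.
have [sd1 sd2] : s < d1 /\ s < d2.
  have : 0 < Num.min d1 d2 by rewrite lt_min d10.
  have : Num.min d1 d2 <= d1 by rewrite ge_min lexx.
  have : Num.min d1 d2 <= d2 by rewrite ge_min lexx orbT.
  by rewrite /s; lra.
have A := nij s; rewrite s0 sd1 in A; have {}A := A isT.
have B := nji s; rewrite s0 sd2 in B; have {}B := B isT.
have E (v w : V) : u (x + v + w) = u (x + w + v) by rewrite addrAC.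
rewrite (E (s *: delta_mx 0 j)) in B.
move: A B; move: (partial _ _ _) (partial _ _ _) => a b.
move: (u _) (u _) (u _) (u _) => p q r w Ha Hb.
have s20 : 0 < s ^+ 2 by rewrite exprn_gt0.
rewrite -(ler_pM2r s20) -[X in _ * X](gtr0_norm s20) -normrM.
move: Ha Hb; rewrite !ler_norml => /andP[Ha1 Ha2] /andP[Hb1 Hb2].
by apply/andP; split; lra.
Qed.

End C1.

(** * Derivatives in one variable *)

Section OneVariable.
Context {R : realType}.
Implicit Types a b g : R -> R.

(** A positive second derivative would make the first derivative positive on
    the right of 0, and the mean value theorem would then contradict the
    maximality. *)
Lemma second_derivative_test g g' (g2 : R) :
  (\forall t \near (0:R), is_derive (t:R) 1 g (g' t)) ->
  is_derive (0:R) 1 g' g2 -> (\forall t \near (0:R), g t <= g 0) ->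
  g' 0 = 0 /\ g2 <= 0.
Proof.
move=> gd g'd gmax.
have /nbhs_ballP[d /= d0 Hd] : \forall t \near (0:R),
   is_derive (t:R) 1 g (g' t) /\ g t <= g 0 by apply: filterI.
have Hd' t : - d < t < d -> is_derive (t:R) 1 g (g' t) /\ g t <= g 0.
  by move=> td; apply: Hd; rewrite /ball /= sub0r normrN ltr_norml.
have g0 : g' 0 = 0.
  have [|||t|_ E] := @derive1_at_max _ g (- d) d 0.
  - lra.
  - by move=> t; rewrite in_itv /= => /Hd'[[]].
  - by rewrite in_itv /= oppr_lt0 d0.
  - by rewrite in_itv /= => /Hd'[].
  by have [[_ E'] _] := Hd' 0 ltac:(lra); rewrite -E'.
split=> //; rewrite leNgt; apply/negP => g2p.
have [g'c g'E] := g'd.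
have : \forall t \near (0:R)^', 0 < t^-1 *: ((g' \o shift 0) (t *: 1) - g' 0).
  have : (fun h => h^-1 *: ((g' \o shift 0) (h *: 1) - g' 0)) @ (0:R)^' --> g2.
    by rewrite -g'E; exact: g'c.
  by move=> /cvgr_gt; apply.
rewrite /= g0 => /nbhs_ballP[e /= e0 He].
pose t := Num.min d e / 2.
have t0 : 0 < t by rewrite divr_gt0// lt_min d0.
have [td te] : t < d /\ t < e.
  have : 0 < Num.min d e by rewrite lt_min d0.
  have : Num.min d e <= d by rewrite ge_min lexx.
  have : Num.min d e <= e by rewrite ge_min lexx orbT.
  rewrite /t; lra.
have [||c ct E] := @MVT _ g g' 0 t t0.
- by move=> s; rewrite in_itv /= => /andP[s0 st]; apply: (Hd' s _).1; lra.
- apply: derivable_within_continuous => s; rewrite in_itv /= => /andP[s0 st].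
  by have [[]] := Hd' s ltac:(lra).
move: ct; rewrite in_itv /= => /andP[c0 ct].
have := He c; rewrite /ball /= sub0r normrN (gtr0_norm c0) => /(_ ltac:(lra) ltac:(lra)).
rewrite addr0 subr0 [c%:A]mulr1 [_ *: _]mulrC pmulr_lgt0 ?invr_gt0// => g'p.
have := (Hd' t ltac:(lra)).2; rewrite -subr_le0 E subr0 leNgt => /negP; apply.
exact: mulr_gt0.
Qed.

Lemma is_derive_comp (V : normedModType R) (h : R -> R) (f : V -> R) (x v : V) (df dh : R) :
  is_derive (f x) 1 h dh -> is_derive x v f df ->
  is_derive x v (fun y => h (f y)) (df * dh).
Proof.
move=> hd fd.
have fd1 : is_derive (0:R) 1 (fun t => f (x + t *: v)) df.
  by apply: is_derive_line; rewrite scale0r addr0.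
have hd1 : is_derive ((fun t => f (x + t *: v)) 0) 1 h dh by rewrite scale0r addr0.
have [] := @is_derive1_comp _ h (fun t => f (x + t *: v)) 0 _ _ hd1 fd1.
rewrite /derivable /derive.
have -> : (fun t : R => t^-1 *: (((h \o (fun r => f (x + r *: v))) \o shift 0) t%:A
   - (h \o (fun r => f (x + r *: v))) 0)) =
   (fun t => t^-1 *: (((fun y => h (f y)) \o shift x) (t *: v) - h (f x))).
  rewrite funeqE => t /=; rewrite scale0r !addr0 [t%:A]mulr1.
  by rewrite (addrC x).
by move=> d1 d2; split=> //; rewrite mulrC.
Qed.

Lemma is_derive_sumf (V : normedModType R) n (h : 'I_n -> V -> R) (x v : V) (dh : 'I_n -> R) :
  (forall i, is_derive x v (h i) (dh i)) ->
  is_derive x v (fun y => \sum_(i < n) h i y) (\sum_(i < n) dh i).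
Proof.
move=> H.
have -> : (fun y => \sum_(i < n) h i y) = \sum_(i < n) h i.
  by apply/funext => y; rewrite fct_sumE.
exact: is_derive_sum.
Qed.

Lemma is_derive_mul (V : normedModType R) (f h : V -> R) (x v : V) (df dh : R) :
  is_derive x v f df -> is_derive x v h dh ->
  is_derive x v (fun y => f y * h y) (df * h x + f x * dh).
Proof.
move=> fd hd; apply: (is_derive_eq (is_deriveM fd hd)).
by rewrite /GRing.scale /= addrC mulrC.
Qed.

Lemma is_derive_add (V : normedModType R) (f h : V -> R) (x v : V) (df dh : R) :
  is_derive x v f df -> is_derive x v h dh ->
  is_derive x v (fun y => f y + h y) (df + dh).
Proof. by move=> fd hd; exact: is_deriveD. Qed.

Lemma is_derive_scal (V : normedModType R) (c : R) (f : V -> R) (x v : V) (df : R) :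
  is_derive x v f df -> is_derive x v (fun y => c * f y) (c * df).
Proof. by move=> fd; exact: (is_deriveZ c fd). Qed.

(** These are the two conditions for the function a^(m+2) b, after division
    by the powers of a that it shares. *)
Lemma log_derivative_test m a a' b b' (a2 b2 : R) :
  (\forall t \near (0:R), is_derive (t:R) 1 a (a' t)) ->
  (\forall t \near (0:R), is_derive (t:R) 1 b (b' t)) ->
  is_derive (0:R) 1 a' a2 -> is_derive (0:R) 1 b' b2 ->
  (\forall t \near (0:R), a t ^+ m.+2 * b t <= a 0 ^+ m.+2 * b 0) ->
  0 < a 0 -> 0 < b 0 ->
  m.+2%:R * a' 0 * b 0 + a 0 * b' 0 = 0 /\
  m.+2%:R * (m.+1%:R * a' 0 ^+ 2 * b 0 + a 0 * a2 * b 0 + 2 * a 0 * a' 0 * b' 0)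
    + a 0 ^+ 2 * b2 <= 0.
Proof.
move=> ad bd a'd b'd mx a0 b0.
have a'0 : is_derive (0:R) 1 a (a' 0) by exact: (nbhs_singleton ad).
have b'0 : is_derive (0:R) 1 b (b' 0) by exact: (nbhs_singleton bd).
have dX k (t da : R) : is_derive t 1 a da ->
    is_derive t 1 (fun s => a s ^+ k.+1) (k.+1%:R * a t ^+ k * da).
  move=> ta; have -> : (fun s => a s ^+ k.+1) = a ^+ k.+1.
    by apply/funext => s; rewrite exprfctE.
  exact: is_deriveX.
pose g t := a t ^+ m.+2 * b t.
pose g' t := m.+2%:R * (a t ^+ m.+1 * (a' t * b t)) + a t ^+ m.+2 * b' t.
have gd : \forall t \near (0:R), is_derive (t:R) 1 g (g' t).
  near=> t.
  have ta : is_derive t 1 a (a' t) by near: t.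
  have tb : is_derive t 1 b (b' t) by near: t.
  apply: (is_derive_eq (is_derive_mul _ _ _ _ _ _ _ (dX m.+1 _ _ ta) tb)).
  by rewrite /g' !mulrA.
have g'd : is_derive (0:R) 1 g'
  (m.+2%:R * (m.+1%:R * a 0 ^+ m * a' 0 * (a' 0 * b 0) + a 0 ^+ m.+1 * (a2 * b 0 + a' 0 * b' 0))
   + (m.+2%:R * a 0 ^+ m.+1 * a' 0 * b' 0 + a 0 ^+ m.+2 * b2)).
  apply: is_derive_add; last exact: (is_derive_mul _ _ _ _ _ _ _ (dX m.+1 _ _ a'0) b'd).
  apply: is_derive_scal; apply: (is_derive_mul _ _ _ _ _ _ _ (dX m _ _ a'0)).
  exact: is_derive_mul.
have [E1 E2] := second_derivative_test g g' _ gd g'd mx.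
have am : 0 < a 0 ^+ m by rewrite exprn_gt0.
have am1 : 0 < a 0 ^+ m.+1 by rewrite exprn_gt0.
split.
  apply: (mulfI (lt0r_neq0 am1)); rewrite mulr0 -[RHS]E1 /g' (exprS _ m.+1); ring.
rewrite -(pmulr_rle0 _ am); move: E2; rewrite !exprS; congr (_ <= 0); ring.
Unshelve. all: by end_near. Qed.

End OneVariable.

(** * Quadratic forms and the graph of u *)

Section Algebra.
Context {R : realType} {n : nat}.
Local Notation V := 'rV[R]_n.
Implicit Types (p r v : V) (M : 'I_n -> 'I_n -> R).

Definition quad M v : R := \sum_(i < n) \sum_(j < n) v 0 i * v 0 j * M i j.

Lemma quad_square (w : 'I_n -> R) v :
  quad (fun i j => w i * w j) v = (\sum_(i < n) v 0 i * w i) ^+ 2.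
Proof.
rewrite expr2 mulr_suml; apply: eq_bigr => i _; rewrite mulr_sumr.
by apply: eq_bigr => j _; ring.
Qed.

Lemma quadD M N v : quad (fun i j => M i j + N i j) v = quad M v + quad N v.
Proof.
rewrite -big_split; apply: eq_bigr => i _; rewrite -big_split.
by apply: eq_bigr => j _; rewrite mulrDr.
Qed.

Lemma quadZ c M v : quad (fun i j => c * M i j) v = c * quad M v.
Proof.
rewrite mulr_sumr; apply: eq_bigr => i _; rewrite mulr_sumr.
by apply: eq_bigr => j _; ring.
Qed.

(** With q = 1 + |p|^2 and c = p . r, expand the squared length of
    q r - c p, which is nonnegative. *)
Lemma dot_sqr_le p r : dot p r ^+ 2 <= (1 + dot p p) * dot r r.
Proof.
set Q := 1 + dot p p; set z := dot p r.
have pp0 : 0 <= dot p p by apply: sumr_ge0 => i _; rewrite -expr2 sqr_ge0.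
have Q0 : 0 < Q by rewrite ltr_pwDl.
have : 0 <= \sum_(i < n) (r 0 i * Q - p 0 i * z) ^+ 2.
  by apply: sumr_ge0 => i _; exact: sqr_ge0.
have E (q c : R) : \sum_(i < n) (r 0 i * q - p 0 i * c) ^+ 2 =
    q ^+ 2 * dot r r - 2 * q * c * dot p r + c ^+ 2 * dot p p.
  rewrite /dot !mulr_sumr -sumrB -big_split /=.
  by apply: eq_bigr => i _; ring.
rewrite E -/z.
have -> : dot p p = Q - 1 by rewrite /Q; ring.
move=> H; rewrite -(ler_pM2l Q0); move: (sqr_ge0 z); nra.
Qed.

(** The vectors are the rows of the symmetric square root
    I - p p^T / (W (W + 1)) of the inverse metric I - p p^T / W^2, where
    W^2 = 1 + |p|^2.  This reduces the contraction of a Hessian with the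
    inverse metric to second derivatives along lines. *)
Lemma inverse_metric_frame p : exists w : 'I_n -> V, forall M,
  \sum_(k < n) quad M (w k) = \sum_(i < n) M i i - quad M p / (1 + dot p p).
Proof.
set Q := 1 + dot p p; pose W := Num.sqrt Q.
have pp0 : 0 <= dot p p by apply: sumr_ge0 => i _; rewrite -expr2 sqr_ge0.
have Q0 : 0 < Q by rewrite ltr_pwDl.
have W0 : 0 < W by rewrite sqrtr_gt0.
have WQ : W ^+ 2 = Q by rewrite sqr_sqrtr// ltW.
pose beta := (W * (W + 1))^-1.
exists (fun k => \row_i ((k == i)%:R - beta * p 0 k * p 0 i)) => M.
have frame i j : \sum_(k < n) ((k == i)%:R - beta * p 0 k * p 0 i) *
    ((k == j)%:R - beta * p 0 k * p 0 j) = (i == j)%:R - p 0 i * p 0 j / Q.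
  transitivity (\sum_(k < n) ((k == i)%:R * (k == j)%:R)
    - beta * p 0 i * \sum_(k < n) ((k == j)%:R * p 0 k)
    - beta * p 0 j * \sum_(k < n) ((k == i)%:R * p 0 k)
    + beta ^+ 2 * p 0 i * p 0 j * dot p p).
    rewrite /dot !mulr_sumr -!sumrB -big_split /=; apply: eq_bigr => k _; ring.
  have sel l (h : 'I_n -> R) : \sum_(k < n) ((k == l)%:R * h k) = h l.
    rewrite (bigD1 l)//= big1 => [|k kl]; last by rewrite (negbTE kl) mul0r.
    by rewrite eqxx mul1r addr0.
  rewrite !sel; have -> : dot p p = W ^+ 2 - 1 by rewrite WQ /Q; ring.
  rewrite -WQ /beta; field.
  by rewrite !lt0r_neq0// addr_gt0.
transitivity (\sum_(i < n) \sum_(j < n) ((i == j)%:R - p 0 i * p 0 j / Q) * M i j).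
  rewrite exchange_big; apply: eq_bigr => i _; rewrite exchange_big; apply: eq_bigr => j _.
  by rewrite -frame mulr_suml; apply: eq_bigr => k _; rewrite !mxE.
rewrite /quad mulr_suml -sumrB; apply: eq_bigr => i _.
rewrite mulr_suml (bigD1 i)//= eqxx [in RHS](bigD1 i)//= opprD addrA mulrBl mul1r.
congr (_ + _); first by rewrite mulrAC.
by rewrite -sumrN; apply: eq_bigr => j ij; rewrite eq_sym (negbTE ij) sub0r mulNr mulrAC.
Qed.

End Algebra.

Section Interior.
Context {R : realType} {n : nat}.
Local Notation V := 'rV[R]_n.
Implicit Types (u phi : V -> R) (x y z v : V) (Omega : set V).

Definition Wsq u y : R := 1 + \sum_(l < n) partial l u y ^+ 2.
Definition hess u y (i j : 'I_n) : R := partial j (partial i u) y.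
(** The third derivatives of u enter only through their contraction with
    grad u. *)
Definition dhess u y (i j : 'I_n) : R :=
  \sum_(l < n) partial l u y * partial l (partial j (partial i u)) y.

Lemma Ck_partial k Omega u i : Ck k.+1 Omega u -> Ck k Omega (partial i u).
Proof. by case=> _ /(_ i)[]. Qed.

Lemma Wsq_gt0 u y : 0 < Wsq u y.
Proof. by rewrite /Wsq ltr_pwDl// sumr_ge0// => i _; rewrite sqr_ge0. Qed.

Lemma Wsq_is_derive {Omega u y} v : open Omega -> Ck 2 Omega u -> Omega y ->
  is_derive y v (Wsq u)
    (2 * \sum_(l < n) partial l u y * \sum_(i < n) v 0 i * hess u y l i).
Proof.
move=> oO u2 Oy; rewrite -[X in is_derive _ _ _ X]add0r.
apply: is_derive_add; rewrite mulr_sumr; apply: is_derive_sumf => l.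
have D := C1_is_derive v oO (Ck_partial _ _ _ l u2) Oy.
have -> : (fun y => partial l u y ^+ 2) = (fun y => partial l u y * partial l u y).
  by apply/funext => w; rewrite expr2.
apply: is_derive_eq (is_derive_mul _ _ _ _ _ _ _ D D) _.
by rewrite /hess; ring.
Qed.

Lemma partial_eq_in {Omega u w x} i : open Omega -> Omega x ->
  (forall y, Omega y -> u y = w y) -> partial i u x = partial i w x.
Proof.
move=> oO Ox uw; apply: near_eq_derive.
by apply: filterS (open_nbhs_nbhs (conj oO Ox)) => y /uw.
Qed.

Lemma third_partialC {Omega u x} (i j l : 'I_n) : open Omega -> Ck 3 Omega u -> Omega x ->
  partial j (partial i (partial l u)) x = partial l (partial j (partial i u)) x.
Proof.
move=> oO u3 Ox.
rewrite (partial_eq_in (w := partial l (partial i u)) j oO Ox).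
  by apply: (partialC l j oO _ Ox); exact: Ck_partial.
by move=> y Oy; apply: (partialC l i oO _ Oy); exact: CkW.
Qed.

(** The second derivative of [Wsq u] along v contains twice the squared length
    of (Hessian u) v.  By Cauchy-Schwarz this is at least half the squared
    first derivative divided by [Wsq u], which the first order condition
    expresses through the derivative of phi.  Only phi and [dhess] remain. *)
Lemma line_test {Omega u phi} {dphi : 'I_n -> V -> R} {Phi : 'I_n -> 'I_n -> R}
   (m : nat) {x} v :
  open Omega -> Ck 3 Omega u -> Omega x ->
  (forall y v, Omega y -> is_derive y v phi (\sum_(i < n) v 0 i * dphi i y)) ->
  (forall i v, is_derive x v (dphi i) (\sum_(j < n) v 0 j * Phi i j)) ->
  0 < phi x ->
  (\forall y \near x, phi y ^+ m.+2 * Wsq u y <= phi x ^+ m.+2 * Wsq u x) ->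
  let phiv := \sum_(i < n) v 0 i * dphi i x in
  m.+2%:R * phiv * Wsq u x + phi x *
    (2 * \sum_(l < n) partial l u x * \sum_(i < n) v 0 i * hess u x l i) = 0 /\
  m.+2%:R * phi x * quad Phi v - (m.+2%:R ^+ 2 / 2 + m.+2%:R) * phiv ^+ 2
    + 2 * phi x ^+ 2 / Wsq u x * quad (dhess u x) v <= 0.
Proof.
move=> oO u3 Ox phid dphid phi0 mx phiv.
have u2 := CkW _ _ _ u3; have u1 := CkW _ _ _ u2.
pose a t := phi (x + t *: v); pose b t := Wsq u (x + t *: v).
pose a' t := \sum_(i < n) v 0 i * dphi i (x + t *: v).
pose b' t := 2 * \sum_(l < n) partial l u (x + t *: v) * \sum_(i < n) v 0 i * hess u (x + t *: v) l i.
have lineC : (fun t : R => x + t *: v) @ (0:R) --> x.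
  have : (fun t : R => x + t *: v) @ (0:R) --> x + 0 *: v.
    by apply: cvgD; [exact: cvg_cst | apply: cvgZr_tmp; exact: cvg_id].
  by rewrite scale0r addr0.
have nO : \forall t \near (0:R), Omega (x + t *: v).
  by apply: lineC; apply: open_nbhs_nbhs.
have ad : \forall t \near (0:R), is_derive (t:R) 1 a (a' t).
  by near=> t; apply: is_derive_line; apply: phid; near: t.
have bd : \forall t \near (0:R), is_derive (t:R) 1 b (b' t).
  by near=> t; apply: is_derive_line; apply: (Wsq_is_derive v oO u2); near: t.
have x0 : x + 0 *: v = x by rewrite scale0r addr0.
have a'd : is_derive (0:R) 1 a' (quad Phi v).
  apply: is_derive_sumf => i.
  have D : is_derive (0:R) 1 (fun t => dphi i (x + t *: v)) (\sum_(j < n) v 0 j * Phi i j).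
    by apply: is_derive_line; rewrite x0.
  apply: is_derive_eq (is_derive_scal _ (v 0 i) _ _ _ _ D) _.
  by rewrite mulr_sumr; apply: eq_bigr => j _; rewrite mulrA.
pose r l := \sum_(i < n) v 0 i * hess u x l i.
have b'd : is_derive (0:R) 1 b' (2 * \sum_(l < n) r l ^+ 2 + 2 * quad (dhess u x) v).
  rewrite -mulrDr; apply: is_derive_scal.
  have -> : quad (dhess u x) v = \sum_(l < n) partial l u x *
      (\sum_(i < n) \sum_(j < n) v 0 i * v 0 j * partial j (partial i (partial l u)) x).
    rewrite /quad /dhess; under [RHS]eq_bigr do rewrite mulr_sumr.
    rewrite [RHS]exchange_big; apply: eq_bigr => i _.
    under [RHS]eq_bigr do rewrite mulr_sumr.
    rewrite [RHS]exchange_big; apply: eq_bigr => j _.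
    rewrite mulr_sumr; apply: eq_bigr => l _.
    by rewrite (third_partialC i j l oO u3 Ox) mulrCA.
  rewrite -big_split /=; apply: is_derive_sumf => l.
  have D1 : is_derive (0:R) 1 (fun t => partial l u (x + t *: v)) (r l).
    apply: (is_derive_line (partial l u) x v 0); rewrite x0.
    exact: (C1_is_derive v oO (Ck_partial _ _ _ l u2) Ox).
  have D2 : is_derive (0:R) 1 (fun t => \sum_(i < n) v 0 i * hess u (x + t *: v) l i)
     (\sum_(i < n) \sum_(j < n) v 0 i * v 0 j * partial j (partial i (partial l u)) x).
    apply: is_derive_sumf => i.
    have -> : \sum_(j < n) v 0 i * v 0 j * partial j (partial i (partial l u)) x
      = v 0 i * \sum_(j < n) v 0 j * partial j (partial i (partial l u)) x.
      by rewrite mulr_sumr; apply: eq_bigr => j _; rewrite mulrA.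
    apply: is_derive_scal; apply: (is_derive_line (partial i (partial l u)) x v 0); rewrite x0.
    exact: (C1_is_derive v oO (Ck_partial _ _ _ i (Ck_partial _ _ _ l u3)) Ox).
  apply: is_derive_eq (is_derive_mul _ _ _ _ _ _ _ D1 D2) _.
  by rewrite x0 expr2.
have mx' : \forall t \near (0:R), a t ^+ m.+2 * b t <= a 0 ^+ m.+2 * b 0.
  by rewrite /a /b x0; exact: (lineC _ mx).
have := log_derivative_test m a a' b b' _ _ ad bd a'd b'd mx'.
rewrite /a /b /a' /b' x0 -/phiv => /(_ phi0 (Wsq_gt0 _ _))[E1 E2]; split=> //.
have CS : (\sum_(l < n) partial l u x * r l) ^+ 2 <= Wsq u x * \sum_(l < n) r l ^+ 2.
  have := dot_sqr_le (grad u x) (\row_l r l).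
  rewrite /dot /Wsq; congr (_ ^+ 2 <= (1 + _) * _); apply: eq_bigr => l _; by rewrite !mxE ?expr2.
move: E1 E2 CS (Wsq_gt0 u x); rewrite -/r.
move: (Wsq u x) (phi x) phi0 @phiv (quad Phi v) (quad (dhess u x) v) => b0 a0 a00 a1 a2 t.
move: (\sum_(l < n) _ * r l) (\sum_(l < n) r l ^+ 2) => z rr E1 E2 CS b00.
set M := m.+2%:R in E1 E2 *; have m1E : m.+1%:R = M - 1 :> R by rewrite /M -natr1; ring.
rewrite m1E in E2.
have e1 : a0 * z = - (M * a1 * b0) / 2 by apply/eqP; rewrite -subr_eq0; apply/eqP; lra.
have M0 : 0 < M by rewrite /M ltr0n.
rewrite -(pmulr_lle0 _ (exprn_gt0 2 b00)).
have -> : (M * a0 * a2 - (M ^+ 2 / 2 + M) * a1 ^+ 2 + 2 * a0 ^+ 2 / b0 * t) * b0 ^+ 2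
  = b0 * (M * ((M - 1) * a1 ^+ 2 * b0 + a0 * a2 * b0 + 2 * a0 * a1 * (2 * z)) +
     a0 ^+ 2 * (2 * rr + 2 * t)) + 2 * a0 ^+ 2 * (z ^+ 2 - b0 * rr).
  transitivity (b0 * (M * ((M - 1) * a1 ^+ 2 * b0 + a0 * a2 * b0 + 4 * a1 * (a0 * z)) +
     2 * a0 ^+ 2 * t) + 2 * (a0 * z) ^+ 2); last by ring.
  rewrite e1; field; exact: lt0r_neq0.
rewrite -[leRHS]addr0 lerD//; first by rewrite pmulr_rle0.
by rewrite mulr_ge0_le0// ?subr_le0// mulr_ge0// sqr_ge0.
Unshelve. all: by end_near. Qed.

Lemma sum_delta (k : 'I_n) (h : 'I_n -> R) :
  \sum_(i < n) (delta_mx 0 k : V) 0 i * h i = h k.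
Proof.
rewrite (bigD1 k)//= big1 => [|i ik]; last by rewrite mxE (negbTE ik) andbF mul0r.
by rewrite mxE !eqxx mul1r addr0.
Qed.

End Interior.

Section MeanCurvature.
Context {R : realType} {n : nat}.
Local Notation V := 'rV[R]_n.+1.
Implicit Types (u : V -> R) (x y z v : V) (Omega : set V).

Lemma divergence_sum (p : 'I_n.+1 -> R) (h : 'I_n.+1 -> 'I_n.+1 -> R) {W : R} : W != 0 ->
  W ^+ 2 * W * \sum_(i < n.+1) ((2 * \sum_(l < n.+1) p l * h l i) * (- (2 * W ^+ 3)^-1) * p i
      + W^-1 * h i i) =
  W ^+ 2 * \sum_(i < n.+1) h i i - \sum_(i < n.+1) \sum_(j < n.+1) p i * p j * h i j.
Proof.
move=> W0; rewrite big_split mulrDr addrC; congr (_ + _).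
  by rewrite -mulr_sumr; field.
rewrite [in RHS]exchange_big /= -sumrN mulr_sumr; apply: eq_bigr => i _.
transitivity (- (p i * \sum_(l < n.+1) p l * h l i)); first by field.
by rewrite mulr_sumr; congr (- _); apply: eq_bigr => l _; ring.
Qed.

Lemma mean_curvature_expand {Omega u y} : open Omega -> Ck 2 Omega u -> Omega y ->
  Wsq u y * Num.sqrt (Wsq u y) * mean_curvature_op u y =
  Wsq u y * \sum_(i < n.+1) hess u y i i - quad (hess u y) (grad u y).
Proof.
move=> oO u2 Oy.
have E z : (Num.sqrt (1 + enorm (grad u z) ^+ 2))^-1 = (Num.sqrt (Wsq u z))^-1.
  congr (Num.sqrt _)^-1; rewrite /Wsq sqr_sqrtr; last first.
    by apply: sumr_ge0 => i _; rewrite -expr2 sqr_ge0.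
  by congr (_ + _); apply: eq_bigr => l _; rewrite !mxE expr2.
have Q0 := Wsq_gt0 u y.
set W := Num.sqrt (Wsq u y); have W0 : 0 < W by rewrite sqrtr_gt0.
have WQ : W ^+ 2 = Wsq u y by rewrite sqr_sqrtr// ltW.
have hd : is_derive (Wsq u y) 1 (fun s : R => (Num.sqrt s)^-1) (- (2 * W ^+ 3)^-1).
  have D := @is_derive1_sqrt R _ Q0.
  apply: (is_derive_eq (@is_deriveV R Num.sqrt _ _ 1 (lt0r_neq0 W0) D)).
  rewrite -/W /GRing.scale /=; field; exact: lt0r_neq0.
have d i : partial i (fun z => ((Num.sqrt (1 + enorm (grad u z) ^+ 2))^-1 *: grad u z) 0 i) y
   = (2 * \sum_(l < n.+1) partial l u y * hess u y l i) * (- (2 * W ^+ 3)^-1) * partial i u y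
      + W^-1 * hess u y i i.
  rewrite (_ : (fun z => _) = (fun z => (Num.sqrt (Wsq u z))^-1 * partial i u z)); last first.
    by apply/funext => z; rewrite !mxE E.
  have DW : is_derive y (delta_mx 0 i) (Wsq u) (2 * \sum_(l < n.+1) partial l u y * hess u y l i).
    apply: (is_derive_eq (Wsq_is_derive (delta_mx 0 i) oO u2 Oy)).
    congr (2 * _); apply: eq_bigr => l _; congr (_ * _).
    exact: (sum_delta i (hess u y l)).
  have Du : is_derive y (delta_mx 0 i) (partial i u) (hess u y i i).
    have [_ /(_ i)[_ /=[_ /(_ i)[H _]]]] := u2.
    by apply: derivableP; apply: H.
  have Dh := is_derive_comp _ (fun s : R => (Num.sqrt s)^-1) _ _ _ _ _ hd DW.
  exact: (derive_val (is_derive := is_derive_mul _ _ _ _ _ _ _ Dh Du)).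
rewrite /mean_curvature_op /divergence (eq_bigr _ (fun i _ => d i)).
rewrite -WQ (divergence_sum (fun i => partial i u y) (hess u y) (lt0r_neq0 W0)).
congr (_ - _); apply: eq_bigr => i _; apply: eq_bigr => j _.
by rewrite !mxE.
Qed.
End MeanCurvature.

(** * The differentiated equation *)

Section Equation.
Context {R : realType} {n : nat}.
Local Notation V := 'rV[R]_n.+1.
Implicit Types (u : V -> R) (x y z v : V) (Omega : set V).

Definition hess_grad u x i : R := \sum_(j < n.+1) partial j u x * hess u x i j.

Lemma gradE u x i : grad u x 0 i = partial i u x.
Proof. by rewrite mxE. Qed.

Lemma quad_hess_grad u x :
  quad (hess u x) (grad u x) = \sum_(i < n.+1) partial i u x * hess_grad u x i.
Proof.
apply: eq_bigr => i _; rewrite mulr_sumr; apply: eq_bigr => j _.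
by rewrite !mxE mulrA.
Qed.

(** The equation multiplied by W^3, which puts it in nondivergence form. *)
Lemma trace_hess_eq {Omega u f x} : open Omega -> Ck 2 Omega u -> Omega x ->
  mean_curvature_op u x + f (u x) = 0 ->
  Wsq u x * \sum_(i < n.+1) hess u x i i - quad (hess u x) (grad u x) =
  - f (u x) * (Wsq u x * Num.sqrt (Wsq u x)).
Proof.
move=> oO u2 Ox E; rewrite -(mean_curvature_expand oO u2 Ox).
have -> : mean_curvature_op u x = - f (u x) by apply/eqP; rewrite -addr_eq0 E.
by rewrite mulrC.
Qed.

Lemma hess_is_derive {Omega u x} i j : open Omega -> Ck 3 Omega u -> Omega x ->
  is_derive x (grad u x) (fun y => hess u y i j) (dhess u x i j).
Proof.
move=> oO u3 Ox.
have D := C1_is_derive (grad u x) oO (Ck_partial _ _ _ j (Ck_partial _ _ _ i u3)) Ox.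
apply: (is_derive_eq D); apply: eq_bigr => l _; by rewrite mxE.
Qed.

Lemma partial_is_derive {Omega u x} i : open Omega -> Ck 2 Omega u -> Omega x ->
  is_derive x (grad u x) (partial i u) (hess_grad u x i).
Proof.
move=> oO u2 Ox.
have D := C1_is_derive (grad u x) oO (Ck_partial _ _ _ i u2) Ox.
apply: (is_derive_eq D); apply: eq_bigr => l _; by rewrite mxE.
Qed.

(** The nondivergence form of the equation is differentiated at x in the fixed
    direction grad u(x).  Both derivatives of the factors grad u in
    [quad (hess u) (grad u)] give the same sum of squares, as the Hessian is
    symmetric. *)
Lemma differentiated_equation {Omega u f x} {df : R} :
  open Omega -> Ck 3 Omega u -> Omega x -> is_derive (u x) 1 f df ->
  (forall y, Omega y -> mean_curvature_op u y + f (u y) = 0) ->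
  let q := 2 * \sum_(l < n.+1) partial l u x * hess_grad u x l in
  q * (\sum_(i < n.+1) hess u x i i) + Wsq u x * (\sum_(i < n.+1) dhess u x i i)
    - 2 * (\sum_(i < n.+1) hess_grad u x i ^+ 2) - quad (dhess u x) (grad u x) =
  - (df * (\sum_(l < n.+1) partial l u x ^+ 2) * (Wsq u x * Num.sqrt (Wsq u x))
     + 3 / 2 * f (u x) * q * Num.sqrt (Wsq u x)).
Proof.
move=> oO u3 Ox fd Eq q.
have u2 := CkW _ _ _ u3; have u1 := CkW _ _ _ u2.
set W := Num.sqrt (Wsq u x).
have Q0 := Wsq_gt0 u x.
have W0 : 0 < W by rewrite sqrtr_gt0.
have WQ : W ^+ 2 = Wsq u x by rewrite sqr_sqrtr// ltW.
have DQ : is_derive x (grad u x) (Wsq u) q.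
  apply: (is_derive_eq (Wsq_is_derive (grad u x) oO u2 Ox)).
  congr (2 * _); apply: eq_bigr => l _; congr (_ * _).
  by apply: eq_bigr => i _; rewrite mxE.
have DT : is_derive x (grad u x) (fun y => \sum_(i < n.+1) hess u y i i)
    (\sum_(i < n.+1) dhess u x i i).
  by apply: is_derive_sumf => i; exact: (hess_is_derive i i oO u3 Ox).
(* the derivative of the summand p_i p_j u_ij *)
pose dq i j := (hess_grad u x i * partial j u x + partial i u x * hess_grad u x j) * hess u x i j
   + partial i u x * partial j u x * dhess u x i j.
have Dquad : is_derive x (grad u x) (fun y => quad (hess u y) (grad u y))
    (\sum_(i < n.+1) \sum_(j < n.+1) dq i j).
  rewrite (_ : (fun y => _) = fun y => \sum_(i < n.+1) \sum_(j < n.+1)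
     partial i u y * partial j u y * hess u y i j); last first.
    by apply/funext => y; apply: eq_bigr => i _; apply: eq_bigr => j _; rewrite !mxE.
  apply: is_derive_sumf => i; apply: is_derive_sumf => j.
  have Di := partial_is_derive i oO u2 Ox; have Dj := partial_is_derive j oO u2 Ox.
  exact: (is_derive_mul _ _ _ _ _ _ _ (is_derive_mul _ _ _ _ _ _ _ Di Dj)
     (hess_is_derive i j oO u3 Ox)).
have dqE : \sum_(i < n.+1) \sum_(j < n.+1) dq i j =
   2 * (\sum_(i < n.+1) hess_grad u x i ^+ 2) + quad (dhess u x) (grad u x).
  have E1 : \sum_(i < n.+1) \sum_(j < n.+1) hess_grad u x i * partial j u x * hess u x i j
     = \sum_(i < n.+1) hess_grad u x i ^+ 2.
    apply: eq_bigr => i _; rewrite expr2 {3}/hess_grad mulr_sumr.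
    by apply: eq_bigr => j _; rewrite mulrA.
  have E2 : \sum_(i < n.+1) \sum_(j < n.+1) partial i u x * hess_grad u x j * hess u x i j
     = \sum_(i < n.+1) hess_grad u x i ^+ 2.
    rewrite exchange_big /=; apply: eq_bigr => j _; rewrite expr2 {3}/hess_grad mulr_sumr.
    apply: eq_bigr => i _.
    by rewrite /hess (partialC i j oO u2 Ox); ring.
  rewrite mulr_natl mulr2n -{1}E1 -E2 -!big_split /=; apply: eq_bigr => i _.
  rewrite -!big_split /=; apply: eq_bigr => j _.
  rewrite /dq (gradE u x i) (gradE u x j).
  move: (hess_grad u x i) (hess_grad u x j) (partial i u x) (partial j u x).
  move: (hess u x i j) (dhess u x i j) => h dh a b c d; ring.
have DL : is_derive x (grad u x)
   (fun y => Wsq u y * (\sum_(i < n.+1) hess u y i i) - quad (hess u y) (grad u y))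
   (q * (\sum_(i < n.+1) hess u x i i) + Wsq u x * (\sum_(i < n.+1) dhess u x i i)
     - \sum_(i < n.+1) \sum_(j < n.+1) dq i j).
  exact: (is_deriveB (is_derive_mul _ _ _ _ _ _ _ DQ DT) Dquad).
have Dh : is_derive (Wsq u x) 1 (fun s => s * Num.sqrt s) (3 / 2 * W).
  have D1 := @is_derive1_sqrt R _ Q0.
  have Did := @is_derive_id R R (Wsq u x) 1.
  apply: (is_derive_eq (is_derive_mul _ _ _ _ _ _ _ Did D1)).
  by rewrite -/W -WQ; field; exact: lt0r_neq0.
have Du : is_derive x (grad u x) u (\sum_(l < n.+1) partial l u x ^+ 2).
  apply: (is_derive_eq (C1_is_derive (grad u x) oO u1 Ox)).
  by apply: eq_bigr => l _; rewrite mxE expr2.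
have Df := is_derive_comp _ f _ _ _ _ _ fd Du.
have DW := is_derive_comp _ (fun s => s * Num.sqrt s) _ _ _ _ _ Dh DQ.
have DR := is_derive_scal _ (-1) _ _ _ _ (is_derive_mul _ _ _ _ _ _ _ Df DW).
have nE : \forall y \near x,
   Wsq u y * (\sum_(i < n.+1) hess u y i i) - quad (hess u y) (grad u y)
   = -1 * (f (u y) * (Wsq u y * Num.sqrt (Wsq u y))).
  apply: filterS (open_nbhs_nbhs (conj oO Ox)) => y Oy.
  by rewrite (trace_hess_eq oO u2 Oy (Eq y Oy)) mulN1r mulNr.
have := derive_val (is_derive := near_eq_is_derive nE DL).
rewrite (derive_val (is_derive := DR)) -/W dqE => H.
by rewrite -addrA -opprD -H; ring.
Qed.

End Equation.

(** * The interior maximum point *)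

Section RealAlgebra.
Context {R : realType}.

(** Notation: a is the value of the cutoff, s = p . grad phi,
    G = |grad phi|^2, so that S = A(grad phi, grad phi), and trPhi is the
    contraction of A with the Hessian of phi; q is the derivative of
    Q in the direction p and r2 is |(Hessian u) p|^2.  The values of q and r2
    express the first order condition grad Q = - M Q grad phi / a, and the two
    equations that follow are the equation and its derivative. *)
Lemma contracted_inequality (M a Q W P S G s f df q trU trT qT r2 trPhi : R) :
  0 < M -> 0 < a -> 0 < W -> Q = W ^+ 2 -> 0 <= P -> df <= 0 ->
  S = G - s ^+ 2 / Q ->
  q = - (M * Q * s / a) -> r2 = M ^+ 2 * Q ^+ 2 * G / (4 * a ^+ 2) ->
  Q * trU - q / 2 = - f * (Q * W) ->
  q * trU + Q * trT - 2 * r2 - qT = - (df * P * (Q * W) + 3 / 2 * f * q * W) ->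
  M * a * trPhi - (M ^+ 2 / 2 + M) * S + 2 * a ^+ 2 / Q * (trT - qT / Q) <= 0 ->
  (M / 2 - 1) * S <= - a * (trPhi + f * s / W).
Proof.
move=> M0 a0 W0 QE P0 df0 SE qE rE HU HT H.
have Q0 : 0 < Q by rewrite QE exprn_gt0.
have Qn := lt0r_neq0 Q0; have Wn := lt0r_neq0 W0; have an := lt0r_neq0 a0.
have trUE : trU = (q / 2 - f * (Q * W)) / Q.
  by apply: (mulfI Qn); rewrite [RHS]mulrC divfK//; lra.
have E : trT - qT / Q = (2 * r2 - q * trU - (df * P * (Q * W) + 3 / 2 * f * q * W)) / Q.
  have -> : 2 * r2 - q * trU - (df * P * (Q * W) + 3 / 2 * f * q * W) = Q * trT - qT by lra.
  by field.
have {}E : 2 * a ^+ 2 / Q * (trT - qT / Q) =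
    M ^+ 2 * S + a * f * M * s / W - 2 * a ^+ 2 * df * P / W.
  rewrite E trUE rE qE SE QE; field.
  by rewrite an Wn.
have D0 : 0 <= - (2 * a ^+ 2 * df * P / W).
  have -> : - (2 * a ^+ 2 * df * P / W) = 2 * a ^+ 2 * (- df) * P / W by ring.
  by rewrite divr_ge0 ?(ltW W0)// !mulr_ge0 ?oppr_ge0 ?(ltW a0).
rewrite E in H; rewrite -(ler_pM2l M0).
have -> : M * (- a * (trPhi + f * s / W)) = - (M * a * trPhi) - a * f * M * s / W by ring.
by nra.
Qed.

(** With R2 = 256 / c^2 the gradient of the quadratic part of the cutoff is too
    short to cancel c p, which keeps A(grad phi, grad phi) above c^2 / 4 when
    |p| >= 1. *)
Lemma gradient_large_impossible (K a c R2 Q W P z Y f F N : R) :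
  0 < c -> 0 < a <= 2 -> 0 < W -> Q = W ^+ 2 -> Q = 1 + P -> 1 <= P ->
  R2 * c ^+ 2 = 256 -> 0 <= Y <= 2 * R2 -> z ^+ 2 <= Q * Y -> `|f| <= F -> 0 <= N ->
  8 * (c * F + 2 * N / R2 + 2 * F * (1 + 2 * R2) / R2) < K * c ^+ 2 -> 0 <= K ->
  K * (c ^+ 2 * P - 4 * c * z / R2 + 4 * Y / R2 ^+ 2 - (c * P - 2 * z / R2) ^+ 2 / Q)
    <= - a * (- c * f * W - 2 * (N - P / Q) / R2 + f * (c * P - 2 * z / R2) / W) ->
  False.
Proof.
move=> c0 /andP[a0 a2] W0 QW QP P1 R2E /andP[Y0 Y2] zY fF N0 big K0.
have R0 : 0 < R2 by rewrite -(pmulr_lgt0 _ (exprn_gt0 2 c0)) R2E.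
have Q2 : 2 <= Q by lra.
have Q0 : 0 < Q by lra.
have W1 : 1 <= W by rewrite -(@ler_pXn2r _ 2)// ?nnegrE ?(ltW W0)// expr1n -QW; lra.
have Rn := lt0r_neq0 R0; have Qn := lt0r_neq0 Q0; have Wn := lt0r_neq0 W0.
have F0 : 0 <= F by apply: le_trans fF; exact: normr_ge0.
have zR : z ^+ 2 <= 2 * R2 * Q by apply: (le_trans zY); nra.
(* the square of the right side is R2 Q^2, since c^2 R2 = 256 *)
have z1 : z <= c * R2 * Q / 16.
  apply: le_trans (ler_norm z) _.
  rewrite -(@ler_pXn2r _ 2)// ?nnegrE//; last by rewrite divr_ge0// !mulr_ge0// ltW.
  rewrite real_normK ?num_real//; apply: (le_trans zR).
  have -> : (c * R2 * Q / 16) ^+ 2 = (R2 * c ^+ 2) / 256 * (R2 * Q) * Q by field.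
  rewrite R2E divff// mul1r; have : 0 < R2 * Q by rewrite mulr_gt0.
  by nra.
have z2 : `|z| <= (1 + 2 * R2) * W.
  rewrite -(@ler_pXn2r _ 2)// ?nnegrE//; last by rewrite mulr_ge0//; lra.
  by rewrite real_normK ?num_real//; apply: (le_trans zR); rewrite exprMn -QW ler_pM2r//; nra.
set S := _ - _ ^+ 2 / Q.
have SE : S = c ^+ 2 * (P / Q) - 4 * c / R2 * (z / Q) + 4 / R2 ^+ 2 * (Y - z ^+ 2 / Q).
  by rewrite /S (_ : P = Q - 1); [field; rewrite Qn Rn | lra].
have c20 : 0 < c ^+ 2 by rewrite exprn_gt0.
have S1 : c ^+ 2 / 4 <= S.
  have h1 : 1 / 2 <= P / Q by rewrite ler_pdivlMr//; lra.
  have h2 : 4 * c / R2 * (z / Q) <= c ^+ 2 / 4.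
    have -> : c ^+ 2 / 4 = 4 * c / R2 * (c * R2 / 16) by field.
    rewrite ler_pM2l ?divr_gt0 ?mulr_gt0// ler_pdivrMr//; lra.
  have h3 : 0 <= 4 / R2 ^+ 2 * (Y - z ^+ 2 / Q).
    by rewrite mulr_ge0// ?divr_ge0 ?sqr_ge0// subr_ge0 ler_pdivrMr// mulrC.
  rewrite SE; nra.
move=> H.
have B : - (- c * f * W - 2 * (N - P / Q) / R2 + f * (c * P - 2 * z / R2) / W)
   <= c * F + 2 * N / R2 + 2 * F * (1 + 2 * R2) / R2.
  have -> : - (- c * f * W - 2 * (N - P / Q) / R2 + f * (c * P - 2 * z / R2) / W)
    = c * (f / W) + 2 * (N - P / Q) / R2 + 2 / R2 * (f * z / W).
    by rewrite (_ : P = W ^+ 2 - 1); [field; rewrite Qn Rn Wn | lra].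
  have fF' : f <= F := le_trans (ler_norm _) fF.
  rewrite !lerD//.
  - by rewrite ler_pM2l// ler_pdivrMr//; nra.
  - rewrite ler_pM2r ?invr_gt0// ler_pM2l//.
    have : 0 <= P / Q by rewrite divr_ge0//; lra.
    by lra.
  - have -> : 2 * F * (1 + 2 * R2) / R2 = 2 / R2 * (F * (1 + 2 * R2)) by ring.
    rewrite ler_pM2l ?divr_gt0// ler_pdivrMr// -mulrA.
    by apply: le_trans (ler_norm _) _; rewrite normrM ler_pM.
have B0 : 0 <= c * F + 2 * N / R2 + 2 * F * (1 + 2 * R2) / R2.
  by rewrite !addr_ge0// ?mulr_ge0// ?invr_ge0 ?(ltW c0) ?(ltW R0)//; lra.
have : a * - (- c * f * W - 2 * (N - P / Q) / R2 + f * (c * P - 2 * z / R2) / W)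
   <= 2 * (c * F + 2 * N / R2 + 2 * F * (1 + 2 * R2) / R2).
  apply: (@le_trans _ _ (a * (c * F + 2 * N / R2 + 2 * F * (1 + 2 * R2) / R2))).
    by rewrite ler_pM2l.
  by rewrite ler_wpM2r.
move=> H2.
have H3 : K * (c ^+ 2 / 4) <= K * S by rewrite ler_wpM2l.
by move: H H2 H3; rewrite mulNr -mulrN => H H2 H3; lra.
Qed.
End RealAlgebra.

Section Interior.
Context {R : realType} {n : nat}.
Local Notation V := 'rV[R]_n.+1.
Implicit Types (u : V -> R) (x y z v : V) (Omega : set V).

Lemma coord_is_derive y v (i : 'I_n.+1) :
  is_derive y v (fun w : V => w 0 i) (v 0 i).
Proof.
have D : derivable (id : V -> V) y v by exact: derivable_id.
split; first by move/derivable_mxP: D => /(_ 0 i).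
by have := derive_mx D; rewrite derive_id => /matrixP /(_ 0 i); rewrite mxE.
Qed.

Definition sqdist x0 y : R := \sum_(i < n.+1) (y 0 i - x0 0 i) ^+ 2.

Definition cutoff (c R2 : R) u x0 y : R := 1 + (c * u y - sqdist x0 y / R2).

Definition dcutoff (c R2 : R) u x0 (i : 'I_n.+1) y : R :=
  c * partial i u y - (2 / R2) * (y 0 i - x0 0 i).

Lemma sub_coord_is_derive x0 y v (i : 'I_n.+1) :
  is_derive y v (fun w : V => w 0 i - x0 0 i) (v 0 i).
Proof.
have D := is_deriveB (coord_is_derive y v i) (is_derive_cst (x0 0 i) y v).
by apply: (is_derive_eq D); rewrite subr0.
Qed.

Lemma cutoff_is_derive {Omega u} c R2 x0 y v : open Omega -> Ck 1 Omega u -> Omega y ->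
  is_derive y v (cutoff c R2 u x0) (\sum_(i < n.+1) v 0 i * dcutoff c R2 u x0 i y).
Proof.
move=> oO u1 Oy.
have Du := is_derive_scal _ c _ _ _ _ (C1_is_derive v oO u1 Oy).
have Ds : is_derive y v (sqdist x0) (\sum_(i < n.+1) 2 * (v 0 i * (y 0 i - x0 0 i))).
  apply: is_derive_sumf => i; have D := sub_coord_is_derive x0 y v i.
  rewrite (_ : (fun y => _) = (fun y : V => (y 0 i - x0 0 i) * (y 0 i - x0 0 i))); last first.
    by apply/funext => w; rewrite expr2.
  apply: (is_derive_eq (is_derive_mul _ _ _ _ _ _ _ D D)).
  by move: (v 0 i) (y 0 i - x0 0 i) => a b; ring.
have Ds' := is_derive_scal _ (- R2^-1) _ _ _ _ Ds.
have D := is_derive_add _ _ _ _ _ _ _ (is_derive_cst (1 : R) y v)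
   (is_derive_add _ _ _ _ _ _ _ Du Ds').
rewrite (_ : cutoff c R2 u x0 = (fun y => 1 + (c * u y + - R2^-1 * sqdist x0 y))); last first.
  by apply/funext => w; rewrite /cutoff mulNr [_^-1 * _]mulrC.
apply: (is_derive_eq D).
rewrite add0r !mulr_sumr -big_split; apply: eq_bigr => i _.
by rewrite /dcutoff /=; move: (v 0 i) (partial i u y) (y 0 i - x0 0 i) => a b d; ring.
Qed.

Lemma dcutoff_is_derive {Omega u} c R2 x0 x v i : open Omega -> Ck 2 Omega u -> Omega x ->
  is_derive x v (dcutoff c R2 u x0 i)
    (\sum_(j < n.+1) v 0 j * (c * hess u x i j + (- (2 / R2)) * (i == j)%:R)).
Proof.
move=> oO u2 Ox.
have Du := is_derive_scal _ c _ _ _ _ (C1_is_derive v oO (Ck_partial _ _ _ i u2) Ox).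
have Ds := is_derive_scal _ (2 / R2) _ _ _ _ (sub_coord_is_derive x0 x v i).
apply: (is_derive_eq (is_deriveB Du Ds)).
transitivity (c * (\sum_(j < n.+1) v 0 j * hess u x i j) +
   - (2 / R2) * (\sum_(j < n.+1) v 0 j * (i == j)%:R)).
  rewrite mulNr; congr (_ - _ * _).
  rewrite (bigD1 i)//= big1 => [|j ji]; last by rewrite eq_sym (negbTE ji) mulr0.
  by rewrite eqxx mulr1 addr0.
rewrite !mulr_sumr -big_split /=; apply: eq_bigr => j _.
by move: (v 0 j) (hess u x i j) (_ == _) => a b d; ring.
Qed.

Lemma quad_delta (v : V) : quad (fun i j => (i == j)%:R) v = \sum_(i < n.+1) v 0 i ^+ 2.
Proof.
apply: eq_bigr => i _; rewrite (bigD1 i)//= big1 => [|j ji].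
  by rewrite eqxx mulr1 addr0 expr2.
by rewrite eq_sym (negbTE ji) mulr0.
Qed.

(** The first order condition along the coordinate axes makes (Hessian u) p
    proportional to grad phi.  Hence every second and third derivative of u
    disappears from the sum of the line conditions over the frame. *)
Lemma interior_maximum {Omega u f x x0} {df c R2 F : R} (m : nat) :
  open Omega -> Ck 3 Omega u -> Omega x -> is_derive (u x) 1 f df -> df <= 0 ->
  (forall y, Omega y -> mean_curvature_op u y + f (u y) = 0) -> `|f (u x)| <= F ->
  0 < c -> R2 * c ^+ 2 = 256 ->
  0 < cutoff c R2 u x0 x <= 2 -> sqdist x0 x <= 2 * R2 ->
  (\forall y \near x, cutoff c R2 u x0 y ^+ m.+2 * Wsq u y <=
                      cutoff c R2 u x0 x ^+ m.+2 * Wsq u x) ->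
  8 * (c * F + 2 * n.+1%:R / R2 + 2 * F * (1 + 2 * R2) / R2) < m%:R / 2 * c ^+ 2 ->
  Wsq u x < 2.
Proof.
move=> oO u3 Ox fd df0 Eq fF c0 R2E /andP[a0 a2] Y2 mx mbig.
have u2 := CkW _ _ _ u3; have u1 := CkW _ _ _ u2.
pose g i := dcutoff c R2 u x0 i x.
pose Phi i j := c * hess u x i j + (- (2 / R2)) * (i == j)%:R.
have LT v := line_test m v oO u3 Ox (fun y w Oy => cutoff_is_derive c R2 x0 y w oO u1 Oy)
   (fun i w => dcutoff_is_derive c R2 x0 x w i oO u2 Ox) a0 mx.
set a := cutoff c R2 u x0 x in a0 a2 LT *.
set Q := Wsq u x in LT *; pose W := Num.sqrt Q; pose M : R := m.+2%:R.
have Q0 : 0 < Q := Wsq_gt0 u x.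
have W0 : 0 < W by rewrite sqrtr_gt0.
have WQ : Q = W ^+ 2 by rewrite sqr_sqrtr// ltW.
pose P := \sum_(l < n.+1) partial l u x ^+ 2.
pose p i := partial i u x; pose w i := x 0 i - x0 0 i.
pose z := \sum_(i < n.+1) p i * w i.
pose s := \sum_(i < n.+1) p i * g i.
pose G := \sum_(i < n.+1) g i ^+ 2.
have rE i : hess_grad u x i = - (M * g i * Q) / (2 * a).
  have [E1 _] := LT (delta_mx 0 i).
  have {}E1 : M * g i * Q + a * (2 * hess_grad u x i) = 0.
    apply: etrans E1; congr (_ * _ * _ + _ * (_ * _)).
      by rewrite (sum_delta i (fun k => dcutoff c R2 u x0 k x)).
    apply: eq_bigr => l _; rewrite (sum_delta i (hess u x l)) /hess.
    by rewrite (partialC l i oO u2 Ox).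
  have -> : - (M * g i * Q) = a * (2 * hess_grad u x i).
    by apply/eqP; rewrite eq_sym -addr_eq0 addrC E1.
  by field; exact: lt0r_neq0.
have gE i : g i = c * p i - 2 / R2 * w i by [].
have sE : s = c * P - 2 / R2 * z.
  rewrite /s /P /z !mulr_sumr -sumrB; apply: eq_bigr => i _.
  by rewrite gE -/(p i); move: (p i) (w i) => b d; ring.
have GE : G = c ^+ 2 * P - 4 * c / R2 * z + 4 / R2 ^+ 2 * sqdist x0 x.
  rewrite /G /P /z /sqdist !mulr_sumr -sumrB -big_split /=; apply: eq_bigr => i _.
  rewrite gE -/(p i) -/(w i) -exprVn; move: (p i) (w i) => b d; ring.
have [fr frE] := inverse_metric_frame (grad u x).
have QE : Q = 1 + P by [].
have QE' : 1 + dot (grad u x) (grad u x) = Q.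
  rewrite /Q /Wsq; congr (_ + _); apply: eq_bigr => l _.
  by rewrite (gradE u x l) expr2.
rewrite QE' in frE.
have sumLT : M * a * (\sum_(i < n.+1) Phi i i - quad Phi (grad u x) / Q)
   - (M ^+ 2 / 2 + M) * (G - s ^+ 2 / Q)
   + 2 * a ^+ 2 / Q * (\sum_(i < n.+1) dhess u x i i - quad (dhess u x) (grad u x) / Q) <= 0.
  have -> : G - s ^+ 2 / Q = \sum_(k < n.+1) quad (fun i j => g i * g j) (fr k).
    rewrite frE quad_square; congr (_ - _ ^+ 2 / _); apply: eq_bigr => i _.
    by rewrite (gradE u x i).
  rewrite -!frE !mulr_sumr -sumrB -big_split /=; apply: sumr_le0 => k _.
  by rewrite quad_square; have [_] := LT (fr k).
have q0 := differentiated_equation oO u3 Ox fd Eq.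
have tr0 := trace_hess_eq oO u2 Ox (Eq x Ox).
rewrite -/Q -/W in tr0; rewrite -/Q -/W /= -/P in q0.
have Rn : R2 != 0 by apply: contra_eqN R2E => /eqP ->; rewrite mul0r; lra.
have trPhiE : \sum_(i < n.+1) Phi i i - quad Phi (grad u x) / Q =
   - c * f (u x) * W - 2 * (n.+1%:R - P / Q) / R2.
  have -> : quad Phi (grad u x) = c * quad (hess u x) (grad u x) + - (2 / R2) * P.
    rewrite (quadD (fun i j => c * hess u x i j) (fun i j => - (2 / R2) * (i == j)%:R)).
    rewrite (quadZ c (hess u x)) (quadZ (- (2 / R2)) (fun i j => (i == j)%:R)) quad_delta.
    by congr (_ + _ * _); apply: eq_bigr => i _; rewrite (gradE u x i).
  have -> : \sum_(i < n.+1) Phi i i = c * (\sum_(i < n.+1) hess u x i i) + - (2 / R2) * n.+1%:R.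
    have -> : n.+1%:R = \sum_(i < n.+1) 1 :> R by rewrite sumr_const card_ord.
    rewrite !mulr_sumr -big_split /=; apply: eq_bigr => i _.
    by rewrite /Phi eqxx.
  have -> : quad (hess u x) (grad u x) = Q * (\sum_(i < n.+1) hess u x i i) + f (u x) * (Q * W).
    by rewrite -[f (u x) * _]opprK -mulNr -tr0; ring.
  move: (\sum_(i < n.+1) hess u x i i) (f (u x)) => t f0; field.
  by rewrite Rn lt0r_neq0.
rewrite quad_hess_grad in tr0.
have qE : 2 * (\sum_(l < n.+1) partial l u x * hess_grad u x l) = - (M * Q * s / a).
  have -> : - (M * Q * s / a) = 2 * ((- (M * Q) / (2 * a)) * s) by field; exact: lt0r_neq0.
  congr (2 * _); rewrite /s mulr_sumr; apply: eq_bigr => i _.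
  rewrite rE -/(p i); move: (p i) (g i) => b d; ring.
have r2E : \sum_(i < n.+1) hess_grad u x i ^+ 2 = M ^+ 2 * Q ^+ 2 * G / (4 * a ^+ 2).
  have -> : M ^+ 2 * Q ^+ 2 * G / (4 * a ^+ 2) = (- (M * Q) / (2 * a)) ^+ 2 * G.
    by field; exact: lt0r_neq0.
  rewrite /G mulr_sumr; apply: eq_bigr => i _.
  by rewrite rE -exprMn; congr (_ ^+ 2); move: (g i) => d; ring.
have zC : z ^+ 2 <= Q * sqdist x0 x.
  have := dot_sqr_le (grad u x) (\row_i w i); rewrite QE'.
  congr (_ ^+ 2 <= _ * _); apply: eq_bigr => i _; rewrite !mxE//.
have M0 : 0 < M by rewrite ltr0n.
have P0 : 0 <= P by apply: sumr_ge0 => i _; exact: sqr_ge0.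
rewrite qE in q0; rewrite trPhiE in sumLT.
have tr1 : Q * (\sum_(i < n.+1) hess u x i i) - (- (M * Q * s / a)) / 2 = - f (u x) * (Q * W).
  by rewrite -tr0 -qE; congr (_ - _); field.
have CI := contracted_inequality M a Q W P _ G s _ _ _ _ _ _ _ _ M0 a0 W0 WQ P0 df0
   erefl erefl r2E tr1 q0 sumLT.
rewrite ltNge; apply/negP => Q2.
have P1 : 1 <= P by move: QE Q2; lra.
have N0 : 0 <= n.+1%:R :> R by rewrite ler0n.
have ME : M / 2 - 1 = m%:R / 2 by rewrite /M -addn2 natrD; field.
have Y0 : 0 <= sqdist x0 x <= 2 * R2.
  by rewrite Y2 andbT; apply: sumr_ge0 => i _; exact: sqr_ge0.
have a02 : 0 < a <= 2 by rewrite a0 a2.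
have K0 : 0 <= m%:R / 2 :> R by rewrite divr_ge0.
rewrite ME GE sE in CI.
apply: (gradient_large_impossible (m%:R / 2) a c R2 Q W P z (sqdist x0 x) (f (u x)) F n.+1%:R) => //.
move: CI; congr (_ * (_ - _ + _ - _ ^+ 2 / _) <= _ * (_ + _ * _ / _)).
- ring.
- ring.
- ring.
- ring.
Qed.

End Interior.

(** * The gradient on the boundary *)

Section DotProduct.
Context {R : realType}.

Lemma dotE {n} (v w : 'rV[R]_n) : dot v w = (v *m w^T) 0 0.
Proof. by rewrite mxE; apply: eq_bigr => i _; rewrite mxE. Qed.

Lemma dot_mulmx {m n} (v : 'rV[R]_m) (A : 'M[R]_(m, n)) (w : 'rV[R]_n) :
  dot (v *m A) w = dot v (w *m A^T).
Proof. by rewrite !dotE trmx_mul trmxK mulmxA. Qed.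

Lemma dotDl {n} (v v' w : 'rV[R]_n) : dot (v + v') w = dot v w + dot v' w.
Proof. by rewrite !dotE mulmxDl mxE. Qed.

Lemma dotZl {n} c (v w : 'rV[R]_n) : dot (c *: v) w = c * dot v w.
Proof. by rewrite !dotE -scalemxAl mxE. Qed.

Lemma dotC {n} (v w : 'rV[R]_n) : dot v w = dot w v.
Proof. by apply: eq_bigr => i _; rewrite mulrC. Qed.

Definition append {n} (v : 'rV[R]_n) (s : R) : 'rV[R]_n.+1 :=
  \row_k (if unlift ord_max k is Some j then v 0 j else s).

Lemma append_last {n} (v : 'rV[R]_n) s : append v s 0 ord_max = s.
Proof. by rewrite mxE unlift_none. Qed.

Lemma append_lift {n} (v : 'rV[R]_n) s j : append v s 0 (lift ord_max j) = v 0 j.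
Proof. by rewrite mxE liftK. Qed.

Lemma append_col' {n} (v : 'rV[R]_n) s : col' ord_max (append v s) = v.
Proof. by apply/rowP => j; rewrite mxE append_lift. Qed.

Lemma dot_append {n} (w : 'rV[R]_n.+1) v s :
  dot w (append v s) = dot (col' ord_max w) v + w 0 ord_max * s.
Proof.
rewrite /dot (bigD1_ord ord_max)//= append_last addrC; congr (_ + _).
by apply: eq_bigr => j _; rewrite append_lift mxE.
Qed.

Lemma append_lin {n} (v v' : 'rV[R]_n) (c s s' : R) :
  append (v + c *: v') (s + c * s') = append v s + c *: append v' s'.
Proof. by apply/rowP => k; rewrite !mxE; case: unliftP => [j|] _; rewrite ?mxE. Qed.

Lemma append_eta {n} (w : 'rV[R]_n.+1) : append (col' ord_max w) (w 0 ord_max) = w.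
Proof. by apply/rowP => k; rewrite !mxE; case: unliftP => [j ->|->]; rewrite ?mxE. Qed.

Lemma dot_continuous {n} {T : Type} {F : set_system T} (a : 'rV[R]_n) {FF : Filter F}
    (X : T -> 'rV[R]_n) l : X @ F --> l -> (fun t => dot a (X t)) @ F --> dot a l.
Proof.
move=> Xl; apply: (@cvg_big R 'I_n +%R 0 xpredT add_continuous T F _ (fun i t => a 0 i * X t 0 i)
   (fun i => a 0 i * l 0 i)) => i _.
apply: (@cvgMl_tmp _ _ F FF (fun t => X t 0 i)).
exact: (cvg_comp X (fun M : 'rV[R]_n => M 0 i) Xl (@coord_continuous _ _ _ 0 i l)).
Qed.

Lemma rowP_continuous {T : topologicalType} {n} (F : T -> 'rV[R]_n) :
  (forall j, continuous (fun x => F x 0 j)) -> continuous F.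
Proof.
move=> Fc x; apply/cvgrPdist_lt => e e0.
have : \forall y \near x, forall j, `|F x 0 j - F y 0 j| < e.
  apply: (@filter_forall _ _ (fun j => [set y | `|F x 0 j - F y 0 j| < e]) (nbhs x) (nbhs_filter x)) => j.
  exact: (cvgr_dist_lt _ _ (Fc j x) _ e0).
apply: filterS => y H.
rewrite /Num.Def.normr/= mx_normrE bigmax_lt// => -[i j] _ /=.
by rewrite (ord1 i) !mxE; exact: H.
Qed.

Lemma mulmx_continuous {m n} (A : 'M[R]_(m, n)) : continuous (fun x : 'rV[R]_m => x *m A).
Proof.
apply: rowP_continuous => j x.
rewrite (_ : (fun x => _) = (fun x : 'rV[R]_m => dot (col j A)^T x)).
  exact: (dot_continuous (col j A)^T id x (@cvg_id _ (nbhs x))).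
by apply/funext => y; rewrite dotC mxE; apply: eq_bigr => i _; rewrite !mxE.
Qed.

End DotProduct.

Section Boundary.
Context {R : realType} {n : nat}.
Local Notation V := 'rV[R]_n.+1.
Implicit Types (Omega : set V) (u : V -> R) (Du : V -> V) (x : V).
Implicit Types (Q : 'M[R]_n.+1) (gamma : 'rV[R]_n -> R).

(** A boundary point in the domain of a chart lies on the graph: below it,
    no nearby point would be in Omega, and above it the point itself would. *)
Lemma chart_graph {Omega} {x0 : V} {Q gamma} : open Omega -> bdry Omega x0 ->
  C1_chart Omega x0 Q gamma ->
  gamma (col' ord_max (x0 *m Q)) = (x0 *m Q) 0 ord_max.
Proof.
move=> oO [clx nix] [QQ g1 ch].
have nOx : ~ Omega x0 by move=> Ox; apply: nix; apply: open_nbhs_nbhs.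
apply/eqP; rewrite eq_le; apply/andP; split; rewrite leNgt; apply/negP; last first.
  by move=> lt; apply: nOx; exact: (nbhs_singleton ch).2.
move=> gt.
pose h (x : V) := gamma (col' ord_max (x *m Q)) - (x *m Q) 0 ord_max.
have hc : h @ x0 --> h x0.
  have mc := @mulmx_continuous R _ _ Q x0.
  have lc : (fun x : V => (x *m Q) 0 ord_max) @ x0 --> (x0 *m Q) 0 ord_max.
    exact: (cvg_comp (fun x : V => x *m Q) (fun M : V => M 0 ord_max) mc (@coord_continuous _ _ _ 0 ord_max _)).
  have cc : (fun x : V => col' ord_max (x *m Q)) @ x0 --> col' ord_max (x0 *m Q).
    apply: (@rowP_continuous R V n (fun x : V => col' ord_max (x *m Q))) => j x.
    rewrite (_ : (fun x => _) = (fun x : V => (x *m Q) 0 (lift ord_max j))).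
      exact: (cvg_comp (fun x : V => x *m Q) (fun M : V => M 0 (lift ord_max j)) (@mulmx_continuous R _ _ Q x) (@coord_continuous _ _ _ 0 _ _)).
    by apply/funext => y; rewrite mxE.
  have gc : {for col' ord_max (x0 *m Q), continuous gamma} by case: g1 => /(_ _ I).
  have gcc : (fun x : V => gamma (col' ord_max (x *m Q))) @ x0 --> gamma (col' ord_max (x0 *m Q)).
    exact: (cvg_comp (fun x : V => col' ord_max (x *m Q)) gamma cc gc).
  exact: cvgB gcc lc.
have hp : \forall x \near x0, 0 < h x.
  by apply: (cvgr_gt _ hc); rewrite /h subr_gt0.
have [z [Oz [chz hz]]] := clx _ (filterI ch hp).
by move/chz: Oz; move: hz; rewrite /h subr_gt0 => a b; have := lt_trans a b; rewrite ltxx.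
Qed.

(** The graph is pushed by t into Omega.  On the pushed curve u is
    differentiable, with a derivative close to the constant L to be shown zero,
    while u tends to 0 at both ends as t tends to 0.  The mean value theorem
    between the ends then bounds |L| by an arbitrarily small number. *)
Lemma tangential_derivative {Omega u Du} {x0 : V} {Q gamma} i :
  open Omega -> Ck 1 Omega u ->
  {within closure Omega, continuous u} -> {within closure Omega, continuous Du} ->
  (forall x, Omega x -> Du x = grad u x) -> (forall x, bdry Omega x -> u x = 0) ->
  bdry Omega x0 -> C1_chart Omega x0 Q gamma ->
  dot (append (delta_mx 0 i) (partial i gamma (col' ord_max (x0 *m Q))) *m Q^T) (Du x0) = 0.
Proof.
move=> oO u1 uc Duc DuE u0 bx0 chart.
have graph := chart_graph oO bx0 chart.
have [QQ g1 ch] := chart.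
have QTQ : Q^T *m Q = 1%:M by apply: mulmx1C.
set y' := col' ord_max (x0 *m Q).
pose a : V := append (delta_mx 0 i : 'rV[R]_n) 0 *m Q^T.
pose b : V := append (0 : 'rV[R]_n) 1 *m Q^T.
pose h s := gamma (y' + s *: delta_mx 0 i) - gamma y'.
pose dh s := partial i gamma (y' + s *: delta_mx 0 i).
have h0 : h 0 = 0 by rewrite /h scale0r addr0 subrr.
have lineC : (fun s : R => y' + s *: delta_mx 0 i) @ (0:R) --> y'.
  have : (fun s : R => y' + s *: delta_mx 0 i) @ (0:R) --> y' + 0 *: delta_mx 0 i.
    by apply: cvgD; [exact: cvg_cst | apply: cvgZr_tmp; exact: cvg_id].
  by rewrite scale0r addr0.
have hd (s : R) : is_derive s 1 h (dh s).
  have [_ /(_ i)[/(_ (y' + s *: delta_mx 0 i) I)/derivableP D _]] := g1.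
  have D' := is_derive_line _ _ _ _ _ D.
  by apply: (is_derive_eq (is_deriveB D' (is_derive_cst (gamma y') s 1))); rewrite subr0.
have hc : h @ (0:R) --> 0.
  rewrite -[X in _ --> X]h0; apply: differentiable_continuous.
  by apply/derivable1_diffP; have [] := hd 0.
have dhc : dh @ (0:R) --> dh 0.
  have [_ /(_ i)[_ [/(_ y' I) gc _]]] := g1.
  rewrite [X in _ --> X]/dh scale0r addr0.
  exact: (cvg_comp (fun s : R => y' + s *: delta_mx 0 i) (partial i gamma) lineC gc).
(* psi s t is the graph point over y' + s e_i, raised by t in the last chart
   coordinate *)
pose psi s t := x0 + s *: a + (h s + t) *: b.
have psiQ s t : psi s t *m Q = x0 *m Q + s *: append (delta_mx 0 i : 'rV[R]_n) 0 + (h s + t) *: append (0 : 'rV[R]_n) 1.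
  by rewrite /psi /a /b !mulmxDl -!scalemxAl -!mulmxA QTQ !mulmx1.
have psi' s t : col' ord_max (psi s t *m Q) = y' + s *: delta_mx 0 i.
  rewrite psiQ; apply/rowP => j.
  by rewrite !mxE !liftK !mxE; ring.
have psil s t : (psi s t *m Q) 0 ord_max = gamma (y' + s *: delta_mx 0 i) + t.
  have E (z v w : V) (p q : R) : (z + p *: v + q *: w) 0 ord_max = z 0 ord_max + p * v 0 ord_max + q * w 0 ord_max.
    by rewrite !mxE.
  by rewrite psiQ E !append_last -graph -/y' /h; ring.
pose al z := dot a (Du z); pose be z := dot b (Du z).
pose L := al x0 + dh 0 * be x0.
have clx0 : closure Omega x0 by case: bx0.
have cDu : Du @ within (closure Omega) (nbhs x0) --> Du x0.
  by move/subspace_continuousP : Duc; apply.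
have alc : al @ within (closure Omega) (nbhs x0) --> al x0 by exact: dot_continuous.
have bec : be @ within (closure Omega) (nbhs x0) --> be x0 by exact: dot_continuous.
suff L0 : L = 0.
  rewrite -[RHS]L0 /L /al /be -dotZl -dotDl; congr (dot _ _).
  rewrite /a /b scalemxAl -mulmxDl /dh scale0r addr0; congr (_ *m _).
  by rewrite -append_lin scaler0 addr0 mulr1 add0r.
apply/eqP; rewrite -normr_le0; apply/ler_addgt0Pl => e0 e00; rewrite addr0.
(* three errors e come from the derivative, two from the ends of the curve *)
pose e := e0 / 5; have ep : 0 < e by rewrite divr_gt0.
pose e1 := Num.min 1 (e / (`|dh 0| + 1)).
have e10 : 0 < e1 by rewrite lt_min ltr01 divr_gt0// ltr_wpDl.
pose e2 := e / (`|be x0| + 1).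
have e20 : 0 < e2 by rewrite divr_gt0// ltr_wpDl.
have wF : Filter (within (closure Omega) (nbhs x0)) by exact: within_filter.
have nal := cvgr_dist_lt _ _ alc _ ep.
have nbe := cvgr_dist_lt _ _ bec _ e10.
have /nbhs_ballP[rho /= rho0 Hrho] : \forall z \near x0,
    (Omega z <-> gamma (col' ord_max (z *m Q)) < (z *m Q) 0 ord_max) /\
    (closure Omega z -> `|al x0 - al z| < e /\ `|be x0 - be z| < e1).
  apply: filterI => //.
  have n1 : \forall z \near x0, closure Omega z -> `|al x0 - al z| < e := nal wF.
  have n2 : \forall z \near x0, closure Omega z -> `|be x0 - be z| < e1 := nbe wF.
  by apply: filterS2 n1 n2 => z A B cz; split; [exact: A|exact: B].
pose N := `|a| + `|b| + 1; have N0 : 0 < N by rewrite ltr_wpDl// addr_ge0.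
pose eta := rho / (4 * N); have eta0 : 0 < eta by rewrite divr_gt0// mulr_gt0.
have /nbhs_ballP[d /= d0 Hd] : \forall s \near (0:R), `|h s| < eta /\ `|dh 0 - dh s| < e2.
  apply: filterI; last exact: (cvgr_dist_lt _ _ dhc _ e20).
  apply: filterS (cvgr_dist_lt _ _ hc _ eta0) => s.
  by rewrite sub0r normrN.
pose s1 := Num.min d eta / 2.
have s10 : 0 < s1 by rewrite divr_gt0// lt_min d0.
have [s1d s1e] : s1 < d /\ s1 < eta.
  have : 0 < Num.min d eta by rewrite lt_min d0.
  have : Num.min d eta <= d by rewrite ge_min lexx.
  have : Num.min d eta <= eta by rewrite ge_min lexx orbT.
  rewrite /s1; lra.
have inball s t : 0 <= s <= s1 -> 0 <= t < eta -> ball x0 rho (psi s t).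
  move=> /andP[sa sb] /andP[ta tb].
  have [hs _] : `|h s| < eta /\ `|dh 0 - dh s| < e2.
    by apply: Hd; rewrite /ball /= sub0r normrN ger0_norm//; lra.
  rewrite -ball_normE /= /psi -[x0 + _ + _]addrA opprD addrA subrr sub0r normrN.
  apply: le_lt_trans (ler_normD _ _) _; rewrite !normrZ (ger0_norm sa).
  have ht : `|h s + t| <= 2 * eta.
    by apply: le_trans (ler_normD _ _) _; rewrite (ger0_norm ta); lra.
  have eN : 4 * (eta * N) = rho by rewrite /eta; field; exact: lt0r_neq0.
  have a1 : s * `|a| <= eta * `|a| by rewrite ler_wpM2r//; lra.
  have b1 : `|h s + t| * `|b| <= 2 * eta * `|b| by rewrite ler_wpM2r.
  have := normr_ge0 a; have := normr_ge0 b; rewrite /N in eN.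
  have : 0 <= eta * `|a| by rewrite mulr_ge0// ltW.
  have : 0 <= eta * `|b| by rewrite mulr_ge0// ltW.
  by nra.
have psiball s t r : 0 <= t -> t < r / N -> ball (psi s 0) r (psi s t).
  move=> ta tr; rewrite -ball_normE /= /psi.
  rewrite (_ : x0 + s *: a + (h s + 0) *: b - (x0 + s *: a + (h s + t) *: b) = - t *: b).
    rewrite normrZ normrN (ger0_norm ta).
    apply: (@le_lt_trans _ _ (t * N)); last by rewrite -ltr_pdivlMr.
    by rewrite ler_wpM2l// /N; have := normr_ge0 a; lra.
  by apply/rowP => k; rewrite !mxE; ring.
have inO s t : 0 <= s <= s1 -> 0 < t < eta -> Omega (psi s t).
  move=> ss /andP[ta tb]; apply: (Hrho _ (inball s t ss _)).1.2; first by rewrite ltW.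
  by rewrite psi' psil ltrDl.
have inbdry s : 0 <= s <= s1 -> bdry Omega (psi s 0).
  move=> ss; split.
    move=> B /nbhs_ballP[r /= r0 rB].
    pose t := Num.min eta (r / N) / 2.
    have t0 : 0 < t by rewrite divr_gt0// lt_min eta0 divr_gt0.
    have [te tr] : t < eta /\ t < r / N.
      have : 0 < Num.min eta (r / N) by rewrite lt_min eta0 divr_gt0.
      have : Num.min eta (r / N) <= eta by rewrite ge_min lexx.
      have : Num.min eta (r / N) <= r / N by rewrite ge_min lexx orbT.
      rewrite /t; lra.
    exists (psi s t); split; first by apply: inO; rewrite ?t0.
    by apply: rB; apply: psiball; rewrite ?ltW.
  move=> /interior_subset Op.
  have := (Hrho _ (inball s 0 ss _)).1.1 Op; rewrite lexx eta0 => /(_ isT).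
  by rewrite psi' psil addr0 ltxx.
have lim0 s : 0 <= s <= s1 -> \forall t \near (0:R)^'+, `|u (psi s t)| < e * s1.
  move=> ss; have [cls _] := inbdry s ss.
  have cu : u @ within (closure Omega) (nbhs (psi s 0)) --> u (psi s 0).
    by move/subspace_continuousP : uc; apply.
  have es0 : 0 < e * s1 by rewrite mulr_gt0.
  have wFs : Filter (within (closure Omega) (nbhs (psi s 0))) by exact: within_filter.
  have nu := cvgr_dist_lt _ _ cu _ es0.
  have /nbhs_ballP[r /= r0 rH] : \forall z \near psi s 0, closure Omega z ->
    `|u (psi s 0) - u z| < e * s1 := nu wFs.
  near=> t.
  have t0 : 0 < t by near: t; exact: nbhs_right_gt.
  have te : t < eta by near: t; exact: nbhs_right_lt.
  have tr : t < r / N by near: t; apply: nbhs_right_lt; rewrite divr_gt0.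
  have := rH _ (psiball s t r (ltW t0) tr) _; rewrite (u0 _ (inbdry s ss)) sub0r normrN; apply.
  by apply: subset_closure; apply: inO; rewrite ?t0.
have s1in : 0 <= s1 <= s1 by rewrite lexx ltW.
have s0in : 0 <= (0:R) <= s1 by rewrite lexx ltW.
near (0:R)^'+ => t.
have t0 : 0 < t < eta.
  by apply/andP; split; near: t; [exact: nbhs_right_gt|exact: nbhs_right_lt].
have U1 : `|u (psi s1 t)| < e * s1 by near: t; exact: lim0.
have U0 : `|u (psi 0 t)| < e * s1 by near: t; exact: lim0.
have ud s : 0 <= s <= s1 -> is_derive s 1 (fun s => u (psi s t)) (al (psi s t) + dh s * be (psi s t)).
  move=> ss; have Os := inO s t ss t0.
  have D := @C1_curve R _ Omega u (fun s => psi s t) (a + dh s *: b) s oO u1 Os _.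
  apply: (is_derive_eq (D _)).
    move=> k; rewrite (_ : (fun s => _) = fun s : R => x0 0 k + (s * a 0 k + (h s + t) * b 0 k)); last first.
      by apply/funext => r; rewrite /psi !mxE addrA.
    have D1 := is_derive_mul _ _ _ _ _ _ _ (is_derive_id s 1) (is_derive_cst (a 0 k) s 1).
    have D2 := is_derive_mul _ _ _ _ _ _ _ (is_derive_add _ _ _ _ _ _ _ (hd s) (is_derive_cst t s 1)) (is_derive_cst (b 0 k) s 1).
    apply: (is_derive_eq (is_derive_add _ _ _ _ _ _ _ (is_derive_cst (x0 0 k) s 1) (is_derive_add _ _ _ _ _ _ _ D1 D2))).
    have -> : (a + dh s *: b) 0 k = a 0 k + dh s * b 0 k.
      have E' (v w : V) (r : R) : (v + r *: w) 0 k = v 0 k + r * w 0 k by rewrite !mxE.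
      exact: E'.
    by rewrite /=; move: (a 0 k) (b 0 k) (dh s) (h s) => p q r v; ring.
  rewrite /al /be -dotZl -dotDl DuE//; apply: eq_bigr => k _.
  by rewrite [grad _ _ _ _]mxE.
have [||s sin E] := @MVT _ (fun s => u (psi s t)) (fun s => al (psi s t) + dh s * be (psi s t)) 0 s1 s10.
- by move=> s; rewrite in_itv /= => /andP[a1 a2]; apply: ud; rewrite !ltW.
- by apply: derivable_within_continuous => s; rewrite in_itv /= => /ud[].
have {}sin : 0 <= s <= s1 by move: sin; rewrite in_itv /= => /andP[a1 a2]; rewrite !ltW.
have Oz := inO s t sin t0.
have t0' : 0 <= t < eta by case/andP: t0 => /ltW -> ->.
have [_ /(_ (subset_closure Oz))[Ha Hb]] := Hrho _ (inball s t sin t0').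
have [_ Hdh] : `|h s| < eta /\ `|dh 0 - dh s| < e2.
  by case/andP: sin => sa sb; apply: Hd; rewrite /ball /= sub0r normrN ger0_norm//; lra.
move: E Ha Hb; rewrite subr0; move: (al (psi s t)) (be (psi s t)) => az bz E Ha Hb.
have e1a : e1 <= 1 by rewrite ge_min lexx.
have e1b : `|dh 0| * e1 <= e.
  have : e1 <= e / (`|dh 0| + 1) by rewrite ge_min lexx orbT.
  have p0 : 0 < `|dh 0| + 1 by rewrite ltr_wpDl.
  rewrite ler_pdivlMr// => H; have := normr_ge0 (dh 0); nra.
have bz1 : `|bz| <= `|be x0| + 1.
  rewrite -[bz](subrK (be x0)) addrC; apply: le_trans (ler_normD _ _) _.
  by rewrite lerD2l distrC; lra.
have E1 : `|az + dh s * bz| <= 2 * e.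
  rewrite -(ler_pM2r s10).
  have -> : `|az + dh s * bz| * s1 = `|(az + dh s * bz) * s1| by rewrite normrM (gtr0_norm s10).
  rewrite -E; apply: le_trans (ler_normB _ _) _.
  by rewrite -mulrA mulr_natl mulr2n lerD// ltW.
have E2 : `|L - (az + dh s * bz)| <= 3 * e.
  rewrite (_ : L - _ = (al x0 - az) + dh 0 * (be x0 - bz) + (dh 0 - dh s) * bz); last by rewrite /L; ring.
  apply: le_trans (ler_normD _ _) _.
  have -> : 3 * e = e + e + e by ring.
  rewrite lerD//.
    apply: le_trans (ler_normD _ _) _; rewrite lerD ?(ltW Ha)// normrM.
    by apply: le_trans e1b; rewrite ler_wpM2l// ltW.
  rewrite normrM; apply: (@le_trans _ _ (e2 * (`|be x0| + 1))).
    by rewrite ler_pM// ltW.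
  by rewrite /e2 divfK// lt0r_neq0// ltr_wpDl.
rewrite -[L](subrK (az + dh s * bz)); apply: le_trans (ler_normD _ _) _.
have -> : e0 = 3 * e + 2 * e by rewrite /e; field.
exact: lerD.
Unshelve. all: by end_near. Qed.

(** In chart coordinates the vanishing of the tangential derivatives says that
    Du is a multiple of (grad gamma, -1), that is, of the normal. *)
Lemma boundary_gradient {Omega u Du} {x0 : V} {kappa : R} :
  C1_domain Omega -> Ck 1 Omega u ->
  {within closure Omega, continuous u} -> {within closure Omega, continuous Du} ->
  (forall x, Omega x -> Du x = grad u x) -> (forall x, bdry Omega x -> u x = 0) ->
  (forall x nu, bdry Omega x -> exterior_normal Omega x nu -> dot (Du x) nu = kappa) ->
  bdry Omega x0 -> dot (Du x0) (Du x0) = kappa ^+ 2.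
Proof.
move=> [oO _ _ /(_ x0)charts] u1 uc Duc DuE u0 neumann bx0.
have [Q [gamma chart]] := charts bx0; have [QQ _ _] := chart.
have QTQ : Q^T *m Q = 1%:M by apply: mulmx1C.
set dg := grad gamma (col' ord_max (x0 *m Q)).
pose c : R := (Num.sqrt (1 + enorm dg ^+ 2))^-1.
have dg0 : 0 <= dot dg dg by apply: sumr_ge0 => i _; rewrite -expr2 sqr_ge0.
have c1 : c ^+ 2 * (1 + dot dg dg) = 1.
  rewrite /c exprVn /enorm !sqr_sqrtr ?mulVf// ?addr_ge0//.
  by rewrite lt0r_neq0// ltr_pwDl.
have nuE : exterior_normal Omega x0 (append (c *: dg) (- c) *m Q^T).
  exists Q, gamma; split=> //=; rewrite -mulmxA QTQ mulmx1.
  by rewrite append_col' append_last.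
have := neumann _ _ bx0 nuE; rewrite dotC dot_mulmx trmxK dotC dot_append.
set w := Du x0 *m Q; set wl := w 0 ord_max.
have wE : col' ord_max w = - wl *: dg.
  apply/rowP => i.
  have := tangential_derivative i oO u1 uc Duc DuE u0 bx0 chart.
  rewrite dot_mulmx trmxK dotC dot_append -/w -/wl.
  rewrite dotC /dot (sum_delta i (fun j => col' ord_max w 0 j)) => /eqP; rewrite addr_eq0 => /eqP ->.
  by rewrite mxE [dg 0 i]mxE mulNr.
have -> : dot (Du x0) (Du x0) = dot w w.
  by rewrite /w dot_mulmx -mulmxA QQ mulmx1.
have -> : dot w w = wl ^+ 2 * (1 + dot dg dg).
  rewrite -{2}(append_eta w) dot_append wE dotZl dotC dotZl -/wl; ring.
rewrite wE dotZl dotC dotZl => <-.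
have -> : (- wl * (c * dot dg dg) + wl * - c) ^+ 2 = wl ^+ 2 * (c ^+ 2 * (1 + dot dg dg)) * (1 + dot dg dg) by ring.
by rewrite c1 mulr1.
Qed.

End Boundary.

(** * Null sets and essential suprema *)

Section BoxCovers.
Context {R : realType}.

(** Integrate the hypothesis over [a, b]. *)
Lemma interval_cover_length (v A B : nat -> R) (a b c : R) :
  a <= b -> 0 <= c -> (forall k, 0 <= v k) -> (forall k, A k <= B k) ->
  (forall t : R, a <= t <= b -> (c%:E <= \sum_(0 <= k <oo) (v k * \1_`[A k, B k] t)%:E)%E) ->
  ((c * (b - a))%:E <= \sum_(0 <= k <oo) (v k * (B k - A k))%:E)%E.
Proof.
move=> ab c0 v0 AB H.
pose mu := @lebesgue_measure R.
have len (s t : R) : s <= t -> mu `[s, t]%classic = (t - s)%:E.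
  move=> st; rewrite /mu lebesgue_measure_itv /= lte_fin; case: ltP => // ts.
  have -> : s = t by apply/eqP; rewrite eq_le st.
  by rewrite subrr.
have mf k := measurable_funM (@measurable_cst _ _ (measurableTypeR R) _ `[a, b]%classic (v k))
   (@measurable_indic _ (measurableTypeR R) R `[a, b]%classic `[A k, B k]%classic (measurable_itv _)).
have f0 k (t : R) : (0 <= (v k * \1_`[A k, B k]%classic t)%:E)%E.
  by rewrite lee_fin mulr_ge0.
have -> : (c * (b - a))%:E = (\int[mu]_(t in `[a, b]%classic) (cst c%:E t))%E.
  by rewrite integral_cst// [X in (_ * X)%E](len a b ab).
apply: (@le_trans _ _ (\int[mu]_(t in `[a, b]%classic) (\sum_(0 <= k <oo) (v k * \1_`[A k, B k]%classic t)%:E))%E).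
  apply: ge0_le_integral => //.
  - apply: (ge0_emeasurable_sum (P := xpredT)) => // k _.
    by apply/measurable_EFinP; exact: mf.
rewrite integral_nneseries//; last by move=> k; apply/measurable_EFinP; exact: mf.
apply: lee_nneseries => k _.
  by move=> _; apply: integral_ge0.
under eq_integral do rewrite EFinM.
rewrite ge0_integralZl_EFin//; last first.
  by apply/measurable_EFinP; exact: measurable_indic.
rewrite integral_indic// EFinM lee_wpmul2l// ?lee_fin//.
rewrite -(len _ _ (AB k)); apply: le_measure; rewrite ?inE//.
exact: measurableI.
Qed.
(** The last coordinate is integrated out; its lengths become part of the
    weights w, which is why the induction needs arbitrary weights and an
    arbitrary lower bound c. *)
Lemma box_cover_volume n (w : nat -> R) (A B : nat -> nat -> R) (a b : nat -> R) (c : R) :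
  (forall i, a i <= b i) -> 0 <= c -> (forall k, 0 <= w k) -> (forall k i, A k i <= B k i) ->
  (forall x : nat -> R, (forall i, (i < n)%N -> a i <= x i <= b i) ->
    (c%:E <= \sum_(0 <= k <oo) (w k * \prod_(i < n) \1_`[A k i, B k i] (x i))%:E)%E) ->
  ((c * \prod_(i < n) (b i - a i))%:E <=
     \sum_(0 <= k <oo) (w k * \prod_(i < n) (B k i - A k i))%:E)%E.
Proof.
elim: n w c => [|n IH] w c ab c0 w0 AB H.
  rewrite big_ord0 mulr1; apply: le_trans (H a _) _ => //.
  by apply: lee_nneseries => k _; rewrite ?big_ord0 // mulr1 lee_fin.
rewrite big_ord_recr /= [_ * (b n - a n)]mulrC mulrA.
have -> : (\sum_(0 <= k <oo) (w k * \prod_(i < n.+1) (B k i - A k i))%:E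
  = \sum_(0 <= k <oo) (w k * (B k n - A k n) * \prod_(i < n) (B k i - A k i))%:E)%E.
  apply: eq_eseriesr => k _; rewrite big_ord_recr /=; congr (_%:E); ring.
apply: IH => //.
- by rewrite mulr_ge0// subr_ge0.
- by move=> k; rewrite mulr_ge0// subr_ge0.
move=> x xab.
have -> : (\sum_(0 <= k <oo) (w k * (B k n - A k n) * \prod_(i < n) \1_`[A k i, B k i] (x i))%:E
  = \sum_(0 <= k <oo) ((w k * \prod_(i < n) \1_`[A k i, B k i] (x i)) * (B k n - A k n))%:E)%E.
  by apply: eq_eseriesr => k _; congr (_%:E); ring.
apply: interval_cover_length => //.
  by move=> k; rewrite mulr_ge0// prodr_ge0.
move=> t tab.
pose y i := if i == n then t else x i.
have := H y _; rewrite -(@eq_eseriesr _ (fun k => (w k * \prod_(i < n) \1_`[A k i, B k i] (x i) * \1_`[A k n, B k n] t)%:E)); last first.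
  move=> k _; rewrite big_ord_recr /= mulrA /y eqxx; congr ((_ * _ * _)%:E).
  by apply: eq_bigr => i _; rewrite (ltn_eqF (ltn_ord i)).
apply=> i; rewrite ltnS leq_eqVlt /y; case: eqVneq => [->//|_ /= /xab//].
Qed.

(** Otherwise a box inside Omega would be covered by boxes of half its volume
    in total. *)
Lemma open_not_null n (Omega : set 'rV[R]_n) x :
  open Omega -> Omega x -> ~ lebesgue_null Omega.
Proof.
move=> oO Ox nO.
have /nbhs_ballP[r /= r0 rO] : nbhs x Omega by apply: open_nbhs_nbhs.
(* vectors as functions on nat, the form in which one coordinate at a time can
   be integrated out *)
pose ext (y : 'rV[R]_n) (d : R) (i : nat) : R := if insub i is Some j then y 0 j else d.
have extE y d (i : 'I_n) : ext y d i = y 0 i by rewrite /ext valK.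
pose h : R := r / 2.
have h0 : 0 < h by rewrite divr_gt0.
have [A [B [AB cov vol]]] := nO (h ^+ n / 2) (divr_gt0 (exprn_gt0 n h0) (ltr0Sn R 1)).
pose a i := ext x 0 i; pose b i := ext x 0 i + h.
have V : ((1 * \prod_(i < n) (b i - a i))%:E <=
    \sum_(0 <= k <oo) (1 * \prod_(i < n) (ext (B k) 0 i - ext (A k) 0 i))%:E)%E.
  apply: (@box_cover_volume n (fun=> 1) (fun k => ext (A k) 0) (fun k => ext (B k) 0)) => //.
  - by move=> i; rewrite /a /b lerDl ltW.
  - by move=> k i; rewrite /ext; case: insubP.
  move=> y yab.
  have : Omega (\row_i y i).
    apply: rO; split=> // p q; rewrite (ord1 p) !mxE /ball /=.
    have := yab q (ltn_ord q); rewrite /a /b extE => /andP[y1 y2].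
    by rewrite ler0_norm ?subr_le0//; move: y2; rewrite /h; lra.
  move=> /cov[k _ /= yk].
  have f0 (j : nat) : (0 <= (1 * \prod_(i < n) \1_`[ext (A j) 0 i, ext (B j) 0 i] (y i))%:E :> \bar R)%E.
    by rewrite lee_fin mul1r prodr_ge0.
  apply: le_trans (nneseries_lim_ge k.+1 (fun j _ _ => f0 j)).
  rewrite big_nat_recr //= -[leLHS]add0e; apply: leeD; first exact: sume_ge0.
  rewrite lee_fin mul1r big1 // => i _.
  by rewrite indicE mem_set //= in_itv /= !extE; have := yk i; rewrite mxE.
move: V; rewrite mul1r (eq_bigr (fun=> h)) => [|i _]; last by rewrite /a /b addrC addKr.
rewrite prodr_const card_ord.
rewrite (@eq_eseriesr _ _ (fun k => (\prod_(i < n) (B k 0 i - A k 0 i))%:E)); last first.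
  move=> k _; rewrite mul1r; congr (_%:E); apply: eq_bigr => i _; by rewrite !extE.
by move=> /le_trans /(_ vol); rewrite lee_fin; have := exprn_gt0 n h0; lra.
Qed.
Lemma lebesgue_null0 n : lebesgue_null (set0 : set 'rV[R]_n.+1).
Proof.
move=> e e0; exists (fun=> 0), (fun=> 0); split=> //.
rewrite (@eq_eseriesr _ _ (fun=> 0%E)) => [|k _].
  by rewrite eseries0// lee_fin ltW.
by rewrite big_ord_recl mxE subrr mul0r.
Qed.

Lemma Linfty_norm_le n (Omega : set 'rV[R]_n.+1) g (C : R) :
  0 <= C -> (forall x, Omega x -> `|g x| <= C) -> (Linfty_norm Omega g <= C%:E)%E.
Proof.
move=> C0 gC; apply: ereal_inf_lbound; exists C => //; split=> //.
have -> : [set x | Omega x /\ C < `|g x|] = set0.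
  by apply/seteqP; split=> x //= -[/gC]; rewrite leNgt => /negP.
exact: lebesgue_null0.
Qed.

Lemma le_Linfty_norm n (Omega : set 'rV[R]_n.+1) g (M : R) x :
  open Omega -> (forall y, Omega y -> {for y, continuous g}) ->
  (forall y, Omega y -> `|g y| <= M) -> Omega x ->
  `|g x| <= fine (Linfty_norm Omega g).
Proof.
move=> oO gc gM Ox.
have M0 : 0 <= M := le_trans (normr_ge0 _) (gM x Ox).
have U := Linfty_norm_le _ _ _ _ M0 gM.
have L : (`|g x|%:E <= Linfty_norm Omega g)%E.
  apply: le_ereal_inf_tmp => _ [m [m0 mnull] <-].
  rewrite lee_fin leNgt; apply/negP => mx.
  apply: (@open_not_null n.+1 _ x _ _ mnull) => //.
  rewrite openE => y [Oy my]; rewrite /interior.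
  have no : nbhs y Omega by apply: open_nbhs_nbhs.
  have nm : \forall z \near y, m < `|g z|.
    have cn : (fun z => `|g z|) @ y --> `|g y| by have cg : g @ y --> g y := gc y Oy; exact: (cvg_norm cg).
    exact: (cvgr_gt _ cn).
  by apply: filterS (filterI no nm) => z [].
have F : Linfty_norm Omega g \is a fin_num.
  rewrite fin_numE; apply/andP; split.
    by apply/eqP => E; move: L; rewrite E.
  by apply/eqP => E; move: U; rewrite E.
by rewrite -lee_fin fineK.
Qed.

End BoxCovers.

(** * The global bound *)

Section GlobalBound.
Context {R : realType} {n : nat}.
Local Notation V := 'rV[R]_n.+1.

Lemma sqdist_continuous (x0 : V) : continuous (sqdist x0).
Proof.
apply: (@continuous_big _ _ +%R 0); first exact: add_continuous.
move=> i _ x.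
have D : (fun y : V => y 0 i - x0 0 i) @ x --> x 0 i - x0 0 i.
  have cc : (fun y : V => y 0 i) @ x --> x 0 i := @coord_continuous _ _ _ 0 i x.
  exact: (cvgB cc (cvg_cst (x0 0 i))).
exact: (cvg_comp (fun y : V => y 0 i - x0 0 i) (fun t : R => t ^+ 2) D (@exprn_continuous R 2 _)).
Qed.

Lemma cutoff_cvg {F : set_system V} {FF : Filter F} (u : V -> R) c R2 (x0 x : V) :
  F --> x -> u @ F --> u x -> cutoff c R2 u x0 @ F --> cutoff c R2 u x0 x.
Proof.
move=> Fx ux; apply: cvgD; first exact: cvg_cst.
apply: cvgB; first by apply: cvgMl_tmp.
apply: cvgMr_tmp; apply: (cvg_comp id (sqdist x0) Fx); exact: sqdist_continuous.
Qed.

Lemma cvg_within_subset (T : topologicalType) (U : Type) (A B : set T) (f : T -> U) (x : T) (H : set_system U) :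
  A `<=` B -> f @ within B (nbhs x) --> H -> f @ within A (nbhs x) --> H.
Proof.
move=> AB fH P /fH HP; apply: filterS (HP : nbhs x _) => y HB Ay.
by apply: HB; exact: AB.
Qed.

Lemma closure_ball_compact (Omega : set V) (x0 : V) (r : R) :
  compact (closure Omega `&` [set x | sqdist x0 x <= r]).
Proof.
apply: bounded_closed_compact; last first.
  apply: closedI; first exact: closed_closure.
  apply: (@closed_comp _ _ (sqdist x0) [set t | t <= r]); last exact: closed_le.
  by move=> x _; exact: sqdist_continuous.
exists (`|x0| + (1 + r)); split; first exact: num_real.
move=> N rN x [_ /= xr].
have r0 : 0 <= r by apply: le_trans xr; apply: sumr_ge0 => i _; exact: sqr_ge0.
rewrite -[x](subrK x0) addrC; apply: le_trans (ler_normD _ _) _.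
apply: le_trans (ltW rN); rewrite lerD2l.
rewrite /Num.Def.normr/= mx_normrE; apply: bigmax_le => [|[i j] _ /=]; first by lra.
rewrite (ord1 i) !mxE.
have : (x 0 j - x0 0 j) ^+ 2 <= r.
  apply: le_trans xr; rewrite /sqdist (bigD1 j)//= lerDl.
  by apply: sumr_ge0 => k _; exact: sqr_ge0.
rewrite -[X in X <= r]real_normK ?num_real//; have := normr_ge0 (x 0 j - x0 0 j).
by nra.
Qed.

(** The maximum is taken of max(phi, 0)^(m+2) (1 + |Du|^2) rather than of the
    power of phi itself, so that points with phi < 0 cannot compete when the
    exponent is even. *)
Lemma gradient_bound_at {Omega : set V} {u f Du kappa} {c R2 M F : R} (m : nat) (x0 : V) :
  C1_domain Omega -> Ck 3 Omega u ->
  {within closure Omega, continuous u} -> {within closure Omega, continuous Du} ->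
  (forall x, Omega x -> Du x = grad u x) ->
  (forall x, Omega x -> mean_curvature_op u x + f (u x) = 0) ->
  (forall x, Omega x -> 0 < u x) ->
  (forall x, bdry Omega x -> u x = 0) ->
  (forall x nu, bdry Omega x -> exterior_normal Omega x nu -> dot (Du x) nu = kappa) ->
  (forall t, derivable f t 1) -> (forall x, Omega x -> derive1 f (u x) <= 0) ->
  (forall x, Omega x -> `|u x| <= M) -> (forall x, Omega x -> `|f (u x)| <= F) ->
  0 < c -> c * M <= 1 -> R2 * c ^+ 2 = 256 ->
  8 * (c * F + 2 * n.+1%:R / R2 + 2 * F * (1 + 2 * R2) / R2) < m%:R / 2 * c ^+ 2 ->
  Omega x0 -> Wsq u x0 <= 2 ^+ m.+2 * (2 + kappa ^+ 2).
Proof.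
move=> dom u3 uc Duc DuE eqn upos u0 neu fd f'0 uM fF c0 cM R2E mbig Ox0.
have [oO _ _ _] := dom.
have u2 := CkW _ _ _ u3; have u1 := CkW _ _ _ u2.
have R0 : 0 < R2 by rewrite -(pmulr_lgt0 _ (exprn_gt0 2 c0)) R2E ltr0n.
have M0 : 0 <= M := le_trans (normr_ge0 _) (uM x0 Ox0).
have sq0 y : 0 <= sqdist x0 y by apply: sumr_ge0 => i _; exact: sqr_ge0.
pose S := closure Omega `&` [set x | sqdist x0 x <= 2 * R2].
pose chi := cutoff c R2 u x0.
pose G x := Num.max (chi x) 0 ^+ m.+2 * (1 + dot (Du x) (Du x)).
have QE y : Omega y -> 1 + dot (Du y) (Du y) = Wsq u y.
  move=> Oy; rewrite DuE// /Wsq; congr (_ + _); apply: eq_bigr => l _.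
  by rewrite gradE expr2.
have bd y : closure Omega y -> ~ Omega y -> bdry Omega y.
  by move=> cy ny; split=> // /interior_subset.
have ule y : closure Omega y -> c * u y <= 1.
  move=> cy; have [Oy|ny] := pselect (Omega y).
    apply: le_trans cM; rewrite ler_pM2l//; apply: le_trans (ler_norm _) (uM y Oy).
  by rewrite (u0 _ (bd y cy ny)) mulr0.
have chi2 y : closure Omega y -> chi y <= 2.
  move=> /ule H; rewrite /chi /cutoff; have : 0 <= sqdist x0 y / R2 by rewrite divr_ge0// ltW.
  by lra.
have Sx0 : S x0.
  split; first exact: subset_closure.
  rewrite /= /sqdist big1 => [|i _]; first by lra.
  by rewrite subrr expr0n.
have chi0 : 1 <= chi x0.
  rewrite /chi /cutoff /sqdist big1 => [|i _]; last by rewrite subrr expr0n.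
  by rewrite mul0r subr0 lerDl mulr_ge0// ltW// upos.
have Gc : {within S, continuous G}.
  apply/subspace_continuousP => y Sy.
  have wF : Filter (within S (nbhs y)) by exact: within_filter.
  have Scl : S `<=` closure Omega by move=> z [].
  have uS : u @ within S (nbhs y) --> u y.
    by apply: (cvg_within_subset _ _ _ _ _ _ _ Scl); move/subspace_continuousP : uc; apply; exact: Scl.
  have DS : Du @ within S (nbhs y) --> Du y.
    by apply: (cvg_within_subset _ _ _ _ _ _ _ Scl); move/subspace_continuousP : Duc; apply; exact: Scl.
  have chiS : chi @ within S (nbhs y) --> chi y.
    by apply: cutoff_cvg => //; exact: cvg_within.
  have ic : {for chi y, continuous (id : R -> R^o)} by exact: cvg_id.
  have zc : {for chi y, continuous (cst 0 : R -> R^o)} by exact: cvg_cst.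
  have mc : {for chi y, continuous (fun t : R => Num.max t 0)} := continuous_max ic zc.
  have xc : {for Num.max (chi y) 0, continuous (fun t : R => t ^+ m.+2)} by exact: exprn_continuous.
  have cc := cvg_comp chi (fun t : R => Num.max t 0) chiS mc.
  have GX := cvg_comp (fun z => Num.max (chi z) 0) (fun t : R => t ^+ m.+2) cc xc.
  apply: (cvgM GX).
  apply: cvgD; first exact: cvg_cst.
  apply: (@cvg_big R 'I_n.+1 +%R 0 xpredT add_continuous V _ _ (fun i t => Du t 0 i * Du t 0 i)
   (fun i => Du y 0 i * Du y 0 i)) => i _.
  have Di : (fun t => Du t 0 i) @ within S (nbhs y) --> Du y 0 i.
    exact: (cvg_comp Du (fun M : V => M 0 i) DS (@coord_continuous _ _ _ 0 i _)).
  exact: cvgM.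
have [x xS xmax] := EVT_max_rV (ex_intro _ x0 Sx0) (closure_ball_compact Omega x0 (2 * R2)) Gc.
have {}xmax y : S y -> G y <= G x by move=> Sy; apply: xmax; rewrite inE.
move: xS; rewrite inE => Sx; have [cx sx] := Sx.
have Gx0 : Wsq u x0 <= G x0.
  rewrite /G QE// -[leLHS]mul1r ler_wpM2r ?(ltW (Wsq_gt0 _ _))//.
  by rewrite exprn_ege1// le_max chi0.
apply: (le_trans Gx0); apply: (le_trans (xmax x0 Sx0)).
have chix : 0 < chi x.
  rewrite ltNge; apply/negP => neg.
  have := lt_le_trans (Wsq_gt0 u x0) (le_trans Gx0 (xmax x0 Sx0)).
  by rewrite /G (max_idPr neg) expr0n mul0r ltxx.
have Gx : G x = chi x ^+ m.+2 * (1 + dot (Du x) (Du x)) by rewrite /G (max_idPl (ltW chix)).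
rewrite Gx; have dp : 0 <= dot (Du x) (Du x) by apply: sumr_ge0 => i _; rewrite -expr2 sqr_ge0.
apply: ler_pM; rewrite ?exprn_ge0 ?(ltW chix) ?addr_ge0//.
  by rewrite lerXn2r ?nnegrE ?(ltW chix)// chi2.
have [Ox|nOx] := pselect (Omega x); last first.
  rewrite (boundary_gradient dom u1 uc Duc DuE u0 neu (bd x cx nOx)); lra.
rewrite QE//; have k0 := sqr_ge0 kappa.
suff : Wsq u x < 2 by lra.
have near_max : \forall y \near x, chi y ^+ m.+2 * Wsq u y <= chi x ^+ m.+2 * Wsq u x.
  have chic : chi @ x --> chi x.
    have ux : u @ x --> u x by case: u1 => /(_ x Ox).
    exact: (cutoff_cvg u c R2 x0 x (@cvg_id _ (nbhs x)) ux).
  have nO : \forall y \near x, Omega y := open_nbhs_nbhs (conj oO Ox).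
  have nc : \forall y \near x, 0 < chi y by exact: (cvgr_gt _ chic).
  apply: filterS2 nO nc => y Oy cy.
  have cly : closure Omega y := subset_closure Oy.
  have Sy : S y.
    split=> //=; move: cy; rewrite /chi /cutoff => cy.
    have : sqdist x0 y / R2 <= 2 by have := ule y cly; lra.
    by rewrite ler_pdivrMr.
  by have := xmax y Sy; rewrite Gx /G (max_idPl (ltW cy)) !QE.
have fdx : is_derive (u x) 1 f (derive1 f (u x)) by rewrite derive1E; exact: derivableP.
apply: (interior_maximum m oO u3 Ox fdx (f'0 x Ox) eqn (fF x Ox) c0 R2E _ sx near_max mbig).
by rewrite chix chi2.
Qed.

End GlobalBound.

Theorem theorem1p5 (R : realType) :
  exists C : nat -> R -> R -> R -> R,
  forall (n : nat) (Omega : set 'rV[R]_n.+1) (u : 'rV[R]_n.+1 -> R)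
    (f : R -> R) (kappa : R),
    C1_domain Omega ->
    C1_real f ->
    (exists M : R, forall x, Omega x -> `|u x| <= M) ->
    overdetermined_solution Omega f kappa u ->
    (forall x, Omega x -> derive1 f (u x) <= 0) ->
    (Linfty_norm Omega (fun x => enorm (grad u x)) <=
       (C n.+1 kappa (fine (Linfty_norm Omega u))
                     (fine (Linfty_norm Omega (f \o u))))%:E)%E.
Proof.
pose c (M : R) := (M + 1)^-1; pose R2 M := 256 / c M ^+ 2.
pose K (N : nat) M F := 8 * (c M * F + 2 * N%:R / R2 M + 2 * F * (1 + 2 * R2 M) / R2 M).
(* the exponent minus two; it must exceed 2 K / c^2 *)
pose m N M F := Num.bound (2 * K N M F / c M ^+ 2).
exists (fun N kappa M F => Num.sqrt (2 ^+ (m N M F).+2 * (2 + kappa ^+ 2))).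
move=> n Omega u f kappa dom [fd _] [M0 uM0] [u3 [Du [_ uc Duc DuE] [eqn upos u0 neu]]] f'0.
have [oO _ [x1 Ox1] _] := dom.
have ucont y : Omega y -> {for y, continuous u} by case: u3 => /(_ y).
have fcont : continuous f.
  by move=> t; apply: differentiable_continuous; apply/derivable1_diffP.
have [F0 fF0] : exists F0 : R, forall x, Omega x -> `|f (u x)| <= F0.
  have M00 : 0 <= M0 := le_trans (normr_ge0 _) (uM0 x1 Ox1).
  have fc : {within `[- M0, M0], continuous (fun t => `|f t|)}.
    apply: continuous_subspaceT => t; apply: cvg_norm; exact: fcont.
  have [|s _ smax] := EVT_max _ fc; first by lra.
  exists `|f s| => x Ox; apply: smax; rewrite in_itv /=.
  by rewrite -ler_norml uM0.
set M := fine (Linfty_norm Omega u); set F := fine _.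
have uM x : Omega x -> `|u x| <= M by exact: (le_Linfty_norm _ _ _ M0).
have fF x : Omega x -> `|f (u x)| <= F.
  apply: (le_Linfty_norm _ _ _ F0 _ oO) => // y Oy.
  exact: (cvg_comp u f (ucont y Oy) (fcont (u y))).
have MM : 0 <= M := le_trans (normr_ge0 _) (uM x1 Ox1).
have FF : 0 <= F := le_trans (normr_ge0 _) (fF x1 Ox1).
have c0 : 0 < c M by rewrite invr_gt0 ltr_wpDl.
have R2E : R2 M * c M ^+ 2 = 256 by rewrite divfK// expf_neq0// lt0r_neq0.
have cM : c M * M <= 1 by rewrite mulrC ler_pdivrMr ?mul1r ?ltr_wpDl// lerDl.
have R0 : 0 < R2 M by apply: divr_gt0; rewrite ?exprn_gt0// ltr0n.
have mbig : K n.+1 M F < (m n.+1 M F)%:R / 2 * c M ^+ 2.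
  have K0 : 0 <= K n.+1 M F.
    have cp := ltW c0; have Rp := ltW R0; rewrite /K.
    move: (c M) (R2 M) cp Rp => p q p0 q0.
    have h1 : 0 <= p * F by exact: mulr_ge0.
    have h2 : 0 <= 2 * n.+1%:R / q by rewrite divr_ge0// mulr_ge0.
    have h3 : 0 <= 2 * F * (1 + 2 * q) / q by rewrite divr_ge0// mulr_ge0 ?mulr_ge0// addr_ge0// mulr_ge0.
    by rewrite mulr_ge0 ?addr_ge0.
  have : 2 * K n.+1 M F / c M ^+ 2 < (m n.+1 M F)%:R.
    by apply: archi_boundP; apply: divr_ge0; [apply: mulr_ge0 | exact: sqr_ge0].
  rewrite ltr_pdivrMr ?exprn_gt0//; lra.
apply: Linfty_norm_le => [|x Ox]; first exact: sqrtr_ge0.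
have e0 : 0 <= enorm (grad u x) by exact: sqrtr_ge0.
rewrite ger0_norm// /enorm ler_wsqrtr//.
have := gradient_bound_at _ x dom u3 uc Duc DuE eqn upos u0 neu fd f'0 uM fF c0 cM R2E mbig Ox.
apply: le_trans; rewrite /Wsq /dot.
rewrite -[leLHS]add0r lerD//; apply: ler_sum => i _.
by rewrite gradE expr2.
Qed.
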